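(* For all integers $n \ge k \ge 3$ there exist constants $c_1, c_2 > 0$, depending only on $n$ and $k$, such that for every integer $H \ge 1$: (i) if $k$ is odd, then $$c_1\, H^{\frac{n+1}{2}-k+\frac{5k^2-4k+7}{8n}} \le D_n(k,H) \le c_2\, H^{n-\frac{k+1}{2}};$$ (ii) if $k$ is even, then $$c_1\, H^{\frac{n+1}{2}-k+\frac{5k^2-2k+16}{8n}} \le D_n(k,H) \le c_2\, H^{n-\frac{k-1}{2}}.$$
   Context: For a polynomial $f$ of degree $n \ge 1$ over $\mathbb{C}$ with roots $\alpha_1,\dots,\alpha_n$ (listed with multiplicity), put $r(f)=\max_{1\le i\le n}|\alpha_i|$. The roots of $f$ of maximal modulus are the roots of modulus $r(f)$; they are always counted with multiplicity. The height of $f$ is the maximum of the absolute values of its coefficients (including the leading one). For positive integers $k\le n$ and $H$, $D_n(k,H)$ denotes the number of monic integer polynomials $f$ of degree $n$ and height at most $H$ with exactly $k$ (not necessarily distinct) roots of maximal modulus. *)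

(* Defs.v *)
From HB Require Import structures.
From mathcomp Require Import all_boot all_order all_algebra.
From mathcomp Require Import complex.
From mathcomp Require Import finmap.
From mathcomp Require Import boolp classical_sets cardinality reals exp.
From mathcomp Require Import zify.

Set Implicit Arguments.
Unset Strict Implicit.
Unset Printing Implicit Defensive.

Import Order.TTheory GRing.Theory Num.Theory.
Local Open Scope classical_set_scope.
Local Open Scope ring_scope.
Local Open Scope complex_scope.

(* The norm of R[i] takes its values in R[i]; [modulus z] is the same number
   as an element of R. *)
Definition modulus (R : realType) (z : R[i]) : R := complex.Re `|z|.

(* The roots are listed with multiplicity, see [croots_spec]. *)
Definition croots (R : realType) (p : {poly R[i]}) : seq R[i] :=
  sval (closed_field_poly_normal p).

Lemma croots_spec (R : realType) (p : {poly R[i]}) :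
  p = lead_coef p *: \prod_(z <- croots p) ('X - z%:P).
Proof. exact: svalP (closed_field_poly_normal p). Qed.

Definition int_to_cpoly (R : realType) (f : {poly int}) : {poly R[i]} :=
  map_poly (intr : int -> R[i]) f.

(* Moduli are nonnegative, so the default value 0 is harmless. *)
Definition max_modulus (R : realType) (p : {poly R[i]}) : R :=
  \big[Num.max/0]_(z <- croots p) modulus z.

Definition nb_max_roots (R : realType) (p : {poly R[i]}) : nat :=
  count (fun z => modulus z == max_modulus p) (croots p).

Definition height (f : {poly int}) : nat := (\max_(i < size f) `|(f`_i)%R|)%N.

Definition Dset (R : realType) (n k H : nat) : set {poly int} :=
  [set f : {poly int} | [/\ f \is monic, size f = n.+1, (height f <= H)%N
                          & nb_max_roots (int_to_cpoly R f) = k]].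

(* [fset_set] of an infinite set would be empty; [Dset_finite] shows that
   this never happens here. *)
Definition Dcount (R : realType) (n k H : nat) : nat :=
  #|` fset_set (Dset R n k H)|%fset.

Lemma Dset_finite (R : realType) (n k H : nat) : finite_set (Dset R n k H).
Proof.
pose F (g : {ffun 'I_n.+1 -> 'I_(2 * H).+1}) : {poly int} :=
  \poly_(i < n.+1) ((g (inord i))%:Z - H%:Z).
apply: (@sub_finite_set _ _ (F @` setT)); last first.
  by apply: finite_image; exact: finite_finset.
move=> f [_ sf hf _].
have bf (i : 'I_n.+1) : (absz (f`_i)%R <= H)%N.
  have lti : (i < size f)%N by rewrite sf.
  apply: leq_trans hf.
  exact: (leq_bigmax (F := fun j : 'I_(size f) => absz (f`_j)%R) (Ordinal lti)).
exists [ffun i : 'I_n.+1 => inord (absz (f`_i + H%:Z))] => //.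
apply/polyP => i; rewrite coef_poly; case: ltnP => [lti|gei]; last first.
  by rewrite nth_default // sf.
have := bf (inord i); rewrite ffunE inordK // => bi.
by rewrite inordK; lia.
Qed.

(* Main.v *)
(* Upper bounds.  Let [r] be the largest modulus of a root of [f].  Dividing [f]
   by [X - z] with [|z| = r >= 1] divides the height by about [r], so
   [r ^ k = O(H)] when [k] roots have modulus [r]; hence the coefficient of
   [X^(n - i)] is [O(H ^ (min(i, k) / k))], and multiplying these bounds settles
   even [k].  If [k] is odd, some root of modulus [r] is real, so [f] has three
   roots, at distinct positions, with [x ^ 2 = y * w].  For given higher
   coefficients this is a polynomial equation of bounded degree in the constant
   coefficient.  It is an identity only if [f] is, up to the constant coefficient,
   a polynomial in [X ^ m] with [m >= 3] dividing [n]: this follows by letting the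
   constant coefficient tend to infinity, when the roots of [f] are asymptotic to
   multiples of the [n]-th roots of unity.  Either way a factor [H] is gained.

   Lower bounds.  Take [f = u * X ^ l * T(X + rho / X) * h], where [T] has degree
   [l] and all its roots real in [(-r, r)], [h] has degree [n - k] and only roots
   of modulus less than [r], and [r ^ 2 < rho <= 4 * r ^ 2].  The factor [u] is [1]
   for even [k], and [X - s] with [rho = s ^ 2] for odd [k].  The conditions on
   [T] and [h] are open conditions on the coefficients rescaled by powers of [r],
   and the height is [O(r ^ n)], so [r] may be of order [H ^ (1 / n)]. *)

From mathcomp Require Import all_boot all_order all_algebra.
From mathcomp Require Import complex polyrcf.
From mathcomp Require Import finmap boolp classical_sets cardinality reals exp.
From mathcomp Require Import zify ring lra.
From mathcomp Require Import perm mpoly.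
Require Import Defs.

Set Implicit Arguments.
Unset Strict Implicit.
Unset Printing Implicit Defensive.

Import Order.TTheory GRing.Theory Num.Theory.
Local Open Scope ring_scope.
Local Open Scope complex_scope.
Local Open Scope classical_set_scope.

(** * The modulus on [R[i]] as a real absolute value *)

Section Modulus.
Variable R : realType.
Implicit Types z w : R[i].

Lemma modulusE z : `|z| = (modulus z)%:C.
Proof. by rewrite /modulus normc_def. Qed.

Lemma modulus_ge0 z : 0 <= modulus z.
Proof. by rewrite -lecR -modulusE rmorph0. Qed.

Lemma modulus_eq0 z : (modulus z == 0) = (z == 0).
Proof. by rewrite -[RHS]normr_eq0 modulusE -(inj_eq (@complexI R)). Qed.

Lemma modulus0 : modulus (0 : R[i]) = 0.
Proof. by apply/eqP; rewrite modulus_eq0. Qed.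

Lemma modulus_gt0 z : (0 < modulus z) = (z != 0).
Proof. by rewrite lt_neqAle modulus_ge0 andbT eq_sym modulus_eq0. Qed.

Lemma modulusM z w : modulus (z * w) = modulus z * modulus w.
Proof. by apply: complexI; rewrite -modulusE normrM !modulusE rmorphM. Qed.

Lemma modulusX z n : modulus (z ^+ n) = modulus z ^+ n.
Proof. by apply: complexI; rewrite -modulusE normrX !modulusE rmorphXn. Qed.

Lemma modulusN z : modulus (- z) = modulus z.
Proof. by rewrite /modulus normrN. Qed.

Lemma modulusV z : modulus z^-1 = (modulus z)^-1.
Proof. by apply: complexI; rewrite -modulusE normfV !modulusE fmorphV. Qed.

Lemma modulusJ z : modulus z^*%C = modulus z.
Proof. by rewrite /modulus normcJ. Qed.

Lemma modulusR (x : R) : modulus x%:C = `|x|.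
Proof. by rewrite /modulus normc_def /= expr0n addr0 sqrtr_sqr. Qed.

Lemma modulus_nat n : modulus (n%:R : R[i]) = n%:R.
Proof. by rewrite -(rmorph_nat (real_complex R)) modulusR normr_nat. Qed.

Lemma modulus1 : modulus (1 : R[i]) = 1.
Proof. exact: (modulus_nat 1). Qed.

Lemma modulus_int (a : int) : modulus (a%:~R : R[i]) = `|a|%N%:R.
Proof.
by rewrite -(rmorph_int (real_complex R)) modulusR -intr_norm -abszE pmulrn.
Qed.

Lemma modulusD z w : modulus (z + w) <= modulus z + modulus w.
Proof. by rewrite -lecR rmorphD -!modulusE ler_normD. Qed.

Lemma modulusB z w : modulus (z - w) <= modulus z + modulus w.
Proof. by rewrite -(modulusN w) modulusD. Qed.

Lemma modulusDl z w : modulus z - modulus w <= modulus (z + w).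
Proof. by rewrite lerBlDr -{1}(addrK w z) modulusB. Qed.

Lemma modulusBC z w : modulus (z - w) = modulus (w - z).
Proof. by rewrite -modulusN opprB. Qed.

Lemma modulus_sum (I : Type) (r : seq I) (P : pred I) (F : I -> R[i]) :
  modulus (\sum_(i <- r | P i) F i) <= \sum_(i <- r | P i) modulus (F i).
Proof.
elim/big_rec2: _ => [|i y z _ le_zy]; first by rewrite modulus0.
by apply: le_trans (modulusD _ _) _; rewrite lerD2l.
Qed.

Lemma modulus_sqr z : (modulus z ^+ 2)%:C = z * z^*%C.
Proof. by rewrite rmorphXn /= -modulusE sqr_normc. Qed.

End Modulus.

(** * Root lists, the largest modulus, and coefficients in terms of roots *)

Section Roots.
Variable R : realType.
Implicit Types (p q : {poly R[i]}) (s : seq R[i]).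

Lemma croots_monic p : p \is monic -> p = \prod_(z <- croots p) ('X - z%:P).
Proof. by move=> /monicP mp; rewrite {1}[p]croots_spec mp scale1r. Qed.

Lemma croots_prod s :
  perm_eq (croots (\prod_(z <- s) ('X - z%:P))) s.
Proof.
by apply: prod_XsubC_eq; rewrite -croots_monic // monic_prod_XsubC.
Qed.

Lemma size_croots p : p \is monic -> size (croots p) = (size p).-1.
Proof. by move/croots_monic => {2}->; rewrite size_prod_XsubC. Qed.

Lemma mem_croots p z : p \is monic -> (z \in croots p) = root p z.
Proof. by move/croots_monic => {2}->; rewrite root_prod_XsubC. Qed.

Lemma le_max_modulus p z : z \in croots p -> modulus z <= max_modulus p.
Proof.
rewrite /max_modulus; elim: (croots p) => //= w s ihs.
rewrite inE big_cons le_max => /predU1P[->|/ihs ->]; first by rewrite lexx.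
by rewrite orbT.
Qed.

Lemma max_modulus_ge0 p : 0 <= max_modulus p.
Proof.
by rewrite /max_modulus; elim/big_ind: _ => // [x y x0 y0|i _];
  [rewrite le_max x0|exact: modulus_ge0].
Qed.

Lemma max_modulus_prod s : max_modulus (\prod_(z <- s) ('X - z%:P)) =
  \big[Num.max/0]_(z <- s) modulus z.
Proof. exact: perm_big (croots_prod s). Qed.

Lemma nb_max_roots_prod s : nb_max_roots (\prod_(z <- s) ('X - z%:P)) =
  count (fun z => modulus z == \big[Num.max/0]_(z <- s) modulus z) s.
Proof.
by rewrite /nb_max_roots max_modulus_prod; apply/seq.permP/croots_prod.
Qed.

(** For constructed polynomials: [s1] holds the roots on a circle, [s2] those strictly inside it. *)
Lemma max_modulus_cat s1 s2 (r : R) : s1 != [::] ->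
  (forall z, z \in s1 -> modulus z = r) ->
  (forall z, z \in s2 -> modulus z < r) ->
  \big[Num.max/0]_(z <- s1 ++ s2) modulus z = r.
Proof.
move=> s1_neq0 eq_r lt_r.
have r_ge0 : 0 <= r.
  by case: s1 s1_neq0 eq_r => // z s _ /(_ z (mem_head _ _)) <-; apply: modulus_ge0.
apply/le_anti/andP; split.
  rewrite big_seq_cond; elim/big_ind: _ => // [x y xr yr|z].
    by rewrite ge_max xr.
  by rewrite andbT mem_cat => /orP[/eq_r -> //|/lt_r/ltW].
case: s1 s1_neq0 eq_r => // z s _ /(_ z (mem_head _ _)) <-.
by rewrite big_cons le_max lexx.
Qed.

(** Each linear factor at most doubles the constant, so the power of 2 replaces the binomial
    coefficients. *)
Lemma coef_prod_XsubC_le s (r : R) : 0 <= r ->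
  (forall z, z \in s -> modulus z <= r) ->
  forall i, (i <= size s)%N ->
    modulus (\prod_(z <- s) ('X - z%:P))`_i <= 2 ^+ size s * r ^+ (size s - i).
Proof.
move=> r_ge0; elim: s => [|z s ihs] le_r i.
  by rewrite /= leqn0 => /eqP ->; rewrite big_nil coef1 mul1r modulus1.
have {}ihs := ihs (fun w ws => le_r w (@mem_behead _ (z :: s) w ws)).
have {le_r}le_zr := le_r z (mem_head _ _).
rewrite /= big_cons mulrBl coefB coefXM coefCM => le_i.
set p := \prod_(w <- s) _ in ihs *.
have le1 : modulus (z * p`_i) <= 2 ^+ size s * r ^+ ((size s).+1 - i).
  case: (leqP i (size s)) => [le_is|lt_si].
    rewrite modulusM subSn // exprS mulrCA ler_pM ?modulus_ge0 //.
    exact: ihs.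
  rewrite nth_default ?mulr0 ?modulus0 ?mulr_ge0 ?exprn_ge0 //.
  by rewrite size_prod_XsubC.
apply: le_trans (modulusB _ _) _.
rewrite exprS -mulrA mulr_natl mulr2n lerD //.
case: i {le1} le_i => [|i] /= le_i; last by rewrite subSS ihs.
by rewrite modulus0 mulr_ge0 ?exprn_ge0.
Qed.

End Roots.

(** * Moduli of roots bounded through the coefficients *)

Section RootBound.
Variable R : realType.
Implicit Types (p q : {poly R[i]}) (s : seq R[i]).

(** Coefficients are compared from the bottom: [z] times the next coefficient of [q] is the current
    one minus a coefficient of the product. Since [|z| >= 1], each step adds at most one [h]. *)
Lemma coef_div_XsubC_le q (z : R[i]) (h : R) : 1 <= modulus z ->
  (forall i, modulus (('X - z%:P) * q)`_i <= h) ->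
  forall i, modulus z * modulus q`_i <= i.+1%:R * h.
Proof.
move=> z_ge1 le_h.
have h_ge0 : 0 <= h := le_trans (modulus_ge0 _) (le_h 0%N).
elim=> [|i ihi].
  by have := le_h 0%N; rewrite mulrBl coefB coefXM coefCM sub0r modulusN modulusM mul1r.
have := le_h i.+1; rewrite mulrBl coefB coefXM coefCM /= => le_hi.
have -> : modulus z * modulus q`_i.+1 = modulus (q`_i - (q`_i - z * q`_i.+1)).
  by rewrite opprB addrC subrK modulusM.
apply: le_trans (modulusB _ _) _.
rewrite -[i.+2%:R]natr1 mulrDl mul1r lerD //.
by apply: le_trans ihi; rewrite ler_peMl ?modulus_ge0.
Qed.

(* Dividing by [X - z] with [r = modulus z >= 1] divides the largest
   coefficient by at least [r / n]. *)
Lemma equimodular_root_bound s q (n : nat) (h r : R) : 1 <= r ->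
  q \is monic -> (size (\prod_(z <- s) ('X - z%:P) * q)%R <= n.+1)%N ->
  (forall z, z \in s -> modulus z = r) ->
  (forall i, modulus (\prod_(z <- s) ('X - z%:P) * q)`_i <= h) ->
  r ^+ size s <= n%:R ^+ size s * h.
Proof.
move=> r_ge1 mq; elim: s h => [|z s ihs] h.
  rewrite big_nil mul1r !expr0 mul1r => _ _ /(_ (size q).-1).
  by move: mq => /monicP; rewrite /lead_coef => ->; rewrite modulus1.
have mp : \prod_(w <- s) ('X - w%:P) * q \is monic.
  by rewrite monicMl // monic_prod_XsubC.
rewrite big_cons -mulrA.
set p := _ * q in mp ihs *.
rewrite size_monicM ?monicXsubC ?monic_neq0 // size_XsubC /= => sz_p eq_r le_h.
have {}sz_p : (size p < n.+1)%N := sz_p.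
have zr := eq_r z (mem_head _ _).
have r_gt0 : 0 < r by apply: lt_le_trans r_ge1.
have h_ge0 : 0 <= h := le_trans (modulus_ge0 _) (le_h 0%N).
have le_p i : modulus p`_i <= n%:R * h / r.
  rewrite ler_pdivlMr // mulrC -zr.
  have [lt_i|ge_i] := ltnP i (size p); last first.
    by rewrite nth_default // modulus0 mulr0 mulr_ge0.
  apply: le_trans (coef_div_XsubC_le _ le_h i) _; first by rewrite zr.
  by rewrite ler_wpM2r // ler_nat; lia.
have {}ihs := ihs (n%:R * h / r) _ _ le_p.
rewrite /= exprSr -ler_pdivlMr //.
have szp : (size p <= n.+1)%N by lia.
have zsr w : w \in s -> modulus w = r by move=> ws; apply: eq_r; rewrite inE ws orbT.
apply: le_trans (ihs szp zsr) _.
by rewrite exprS !mulrA (mulrC n%:R).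
Qed.

End RootBound.

(** * Integer polynomials over the complex numbers, and their largest roots *)

Section IntPoly.
Variable R : realType.
Local Notation toC := (int_to_cpoly R).
Implicit Types f g : {poly int}.

Lemma toC_inj : injective toC.
Proof. by apply: map_inj_poly => //; apply: intr_inj. Qed.

Lemma toCM f g : toC (f * g) = toC f * toC g.
Proof. exact: rmorphM. Qed.

Lemma size_toC f : size (toC f) = size f.
Proof. by rewrite size_map_inj_poly //; apply: intr_inj. Qed.

Lemma monic_toC f : (toC f \is monic) = (f \is monic).
Proof.
apply/monicP/monicP; rewrite /lead_coef size_toC coef_map /=; last by move->.
by move/eqP; rewrite -[1]/(1%:~R) eqr_int => /eqP.
Qed.

Lemma coef_toC f i : (toC f)`_i = (f`_i)%:~R.
Proof. by rewrite coef_map. Qed.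

Lemma coef_le_height f i : (`|(f`_i)%R| <= height f)%N.
Proof.
have [lti|gei] := ltnP i (size f); last by rewrite nth_default.
exact: (leq_bigmax (F := fun j : 'I_(size f) => `|(f`_j)%R|%N) (Ordinal lti)).
Qed.

Lemma height_leP f (H : nat) :
  (forall i, (`|(f`_i)%R| <= H)%N) -> (height f <= H)%N.
Proof. by move=> le_H; apply/bigmax_leqP => i _; apply: le_H. Qed.

(** All roots of maximal modulus [r] are split off at once and fed to [equimodular_root_bound]. For
    [r < 1] the bound is trivial, as [n] and [H] are at least 1. *)
Lemma max_modulus_bound (n k H : nat) f : (0 < n)%N -> (0 < H)%N -> Dset R n k H f ->
  max_modulus (toC f) ^+ k <= n%:R ^+ k * H%:R.
Proof.
move=> n_gt0 H_gt0 [mf szf hf nbf].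
set r := max_modulus _.
have H_ge1 : 1 <= H%:R :> R by rewrite ler1n.
have n_ge1 : 1 <= n%:R :> R by rewrite ler1n.
have [r_ge1|r_lt1] := leP 1 r; last first.
  apply: (@le_trans _ _ 1).
    by rewrite exprn_ile1 ?max_modulus_ge0 ?ltW.
  by rewrite mulr_ege1 // exprn_ege1.
have mp : toC f \is monic by rewrite monic_toC.
set P := fun z => modulus z == r.
have sz_s : size (filter P (croots (toC f))) = k by rewrite size_filter.
have eq_p : \prod_(z <- filter P (croots (toC f))) ('X - z%:P) *
    \prod_(z <- filter (predC P) (croots (toC f))) ('X - z%:P) = toC f.
  rewrite -big_cat [RHS]croots_monic //; apply: perm_big.
  by rewrite perm_filterC.
rewrite -[k in r ^+ k]sz_s -[k in _%:R ^+ k]sz_s.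
apply: (@equimodular_root_bound R _
  (\prod_(z <- filter (predC P) (croots (toC f))) ('X - z%:P))) => //.
- exact: monic_prod_XsubC.
- by rewrite eq_p size_toC szf.
- by move=> z; rewrite mem_filter => /andP[/eqP].
- move=> i; rewrite eq_p coef_toC modulus_int ler_nat.
  exact: leq_trans (coef_le_height _ _) hf.
Qed.

Lemma coef_bound f i : f \is monic -> (i < size f)%N ->
  modulus (toC f)`_i <=
    2 ^+ (size f).-1 * max_modulus (toC f) ^+ ((size f).-1 - i).
Proof.
move=> mf lt_i; have mp : toC f \is monic by rewrite monic_toC.
have := @coef_prod_XsubC_le R (croots (toC f)) _ (max_modulus_ge0 _)
  (fun z => @le_max_modulus R _ z) i.
rewrite -croots_monic // size_croots // size_toC; apply.
by rewrite -ltnS prednK //; case: (size f) lt_i.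
Qed.

End IntPoly.

(** * Powers and geometric sums near 1 *)

Section PowerEstimates.
Variable R : realType.
Implicit Types (z w : R[i]) (c : nat -> R[i]).

Lemma modulus_geom_sum_le w (n j : nat) : (j <= n)%N -> modulus w <= 2 ->
  modulus (\sum_(i < j) w ^+ i) <= n%:R * 2 ^+ n.
Proof.
move=> le_jn w_le2; apply: le_trans (modulus_sum _ _ _) _.
apply: (@le_trans _ _ (\sum_(i < j) (2 : R) ^+ n)); last first.
  by rewrite sumr_const card_ord -[_ *+ j]mulr_natl ler_wpM2r ?exprn_ge0 // ler_nat.
apply: ler_sum => i _; rewrite modulusX.
apply: (@le_trans _ _ (2 ^+ i)); first by rewrite lerXn2r ?nnegrE ?modulus_ge0.
by rewrite ler_weXn2l ?ler1n // ltnW // (leq_trans (ltn_ord i)).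
Qed.

Lemma modulus_subX1_le w (n j : nat) : (j <= n)%N -> modulus w <= 2 ->
  modulus (w ^+ j - 1) <= n%:R * 2 ^+ n * modulus (w - 1).
Proof.
move=> le_jn w_le2; rewrite subrX1 modulusM mulrC.
by rewrite ler_wpM2r ?modulus_ge0 // modulus_geom_sum_le.
Qed.

Lemma modulusX_le2 w (n j : nat) : (j <= n)%N -> modulus w <= 2 ->
  modulus (w ^+ j) <= 2 ^+ n.
Proof.
move=> le_jn w_le2; rewrite modulusX.
apply: (@le_trans _ _ (2 ^+ j)); first by rewrite lerXn2r ?nnegrE ?modulus_ge0.
by rewrite ler_weXn2l ?ler1n.
Qed.

Lemma modulus_le2_near1 w : modulus (w - 1) <= 1 -> modulus w <= 2.
Proof.
move=> w1; rewrite -(subrK 1 w); apply: le_trans (modulusD _ _) _.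
by rewrite modulus1; lra.
Qed.

(** The inner sum is [(w^j - 1) / (w - 1)]. For [j = n] it lies within 1/2 of [n], and the remaining
    terms total at most 1/4, so at least [n - 3/4] is left. *)
Lemma dominant_geom_sum c w (n : nat) : (0 < n)%N -> c n = 1 ->
  modulus (w - 1) * (2 * n%:R * (n%:R * 2 ^+ n)) <= 1 ->
  4 * (n%:R * 2 ^+ n) * \sum_(j < n) modulus (c j) <= 1 ->
  4^-1 <= modulus (\sum_(j < n.+1) c j * \sum_(i < j) w ^+ i).
Proof.
move=> n_gt0 cn1; set K := n%:R * 2 ^+ n => le_w le_c.
have n_ge1 : 1 <= n%:R :> R by rewrite ler1n.
have K_ge1 : 1 <= K by rewrite mulr_ege1 // exprn_ege1 // ler1n.
have w_ge0 := modulus_ge0 (w - 1).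
have w_le2 : modulus w <= 2.
  apply: modulus_le2_near1; apply: le_trans le_w.
  have nK_ge1 : 1 <= n%:R * K by rewrite mulr_ege1.
  by rewrite ler_peMr // -mulrA; lra.
pose G j := \sum_(i < j) w ^+ i.
rewrite -[\sum_(j < _) _]/(\sum_(j < n.+1) c j * G j) big_ord_recr /= cn1 mul1r.
set S := G n.
set X := (X in X + S).
have -> : X + S =
   n%:R + (X + (S - n%:R)) by ring.
apply: le_trans (modulusDl _ _); rewrite modulus_nat.
have le1 : modulus (X) <=
    K * \sum_(j < n) modulus (c j).
  apply: le_trans (modulus_sum _ _ _) _; rewrite mulr_sumr.
  apply: ler_sum => j _; rewrite modulusM mulrC.
  by rewrite ler_wpM2r ?modulus_ge0 // modulus_geom_sum_le // ltnW.
have le2 : modulus (S - n%:R) <= n%:R * (K * modulus (w - 1)).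
  have -> : S - n%:R = \sum_(i < n) (w ^+ i - 1).
    by rewrite /S /G big_split /= sumr_const card_ord mulNrn.
  apply: le_trans (modulus_sum _ _ _) _.
  apply: (@le_trans _ _ (\sum_(i < n) K * modulus (w - 1))).
    by apply: ler_sum => i _; apply: modulus_subX1_le => //; apply: ltnW.
  by rewrite sumr_const card_ord mulr_natl.
have := modulusD (X) (S - n%:R).
by nra.
Qed.

End PowerEstimates.

(** * Solutions [w] of [F(z w) = F(z)] for large [z] *)

Section Asymptotics.
Variables (R : realType) (n : nat) (F : {poly R[i]}).
Hypotheses (n_gt0 : (0 < n)%N) (mF : F \is monic) (szF : size F = n.+1).
Implicit Types z w : R[i].

Let A : R := \sum_(j < n) modulus F`_j.
Let K : R := n%:R * 2 ^+ n.
(** These are the coefficients of [F(z X) / z^n]: the leading one is 1, the others tend to 0 as [z]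
    grows. *)
Let b z j : R[i] := F`_j * z^-1 ^+ (n - j).

Let A_ge0 : 0 <= A.
Proof. by apply: sumr_ge0 => j _; apply: modulus_ge0. Qed.

Let K_ge1 : 1 <= K.
Proof. by rewrite mulr_ege1 ?ler1n // exprn_ege1 // ler1n. Qed.

Let bn z : b z n = 1.
Proof. by move: mF => /monicP; rewrite /b /lead_coef szF /= => ->; rewrite subnn mulr1. Qed.

Let modulus_b z j : modulus (b z j) = modulus F`_j * (modulus z)^-1 ^+ (n - j).
Proof. by rewrite modulusM modulusX modulusV. Qed.

Let sum_b_le z (P : pred 'I_n) (m : nat) : (modulus z)^-1 <= 1 ->
  (forall j : 'I_n, P j -> (m <= n - j)%N) ->
  \sum_(j < n | P j) modulus (b z j) <= A * (modulus z)^-1 ^+ m.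
Proof.
move=> z_ge1 leP; rewrite mulr_suml [leRHS](bigID P) /= ler_wpDr //.
  by apply: sumr_ge0 => j _; rewrite mulr_ge0 ?exprn_ge0 ?invr_ge0 ?modulus_ge0.
apply: ler_sum => j Pj; rewrite modulus_b ler_wpM2l ?modulus_ge0 //.
by rewrite ler_wiXn2l ?invr_ge0 ?modulus_ge0 // leP.
Qed.

Let sum_b_le1 z : (modulus z)^-1 <= 1 ->
  \sum_(j < n) modulus (b z j) <= A * (modulus z)^-1.
Proof. by move=> z1; apply: (sum_b_le z1 (m := 1)) => j _; rewrite subn_gt0. Qed.

Let horner_scale z w : z != 0 ->
  F.[z * w] - F.[z] = z ^+ n * \sum_(j < n.+1) b z j * (w ^+ j - 1).
Proof.
move=> z_neq0; rewrite !horner_coef szF -sumrB mulr_sumr.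
apply: eq_bigr => -[j /= le_jn] _; rewrite /b exprMn exprVn.
have -> : z ^+ n = z ^+ j * z ^+ (n - j) by rewrite -exprD subnKC.
by field; rewrite expf_neq0.
Qed.

Let shift_eq z w : z != 0 -> F.[z * w] = F.[z] ->
  \sum_(j < n.+1) b z j * (w ^+ j - 1) = 0.
Proof.
move=> z_neq0 /eqP; rewrite -subr_eq0 horner_scale // mulf_eq0 expf_eq0.
by rewrite (negbTE z_neq0) andbF => /eqP.
Qed.

(** Taking the factor [w - 1] out of [F(z w) - F(z)] leaves the sum of [dominant_geom_sum], which is
    nonzero for [w] near 1. At [w = 1] this sum is [z F'(z) / z^n], whence the claim on the
    derivative. *)
Lemma large_roots_separated : exists d M : R, [/\ 0 < d, 0 < M &
  forall z, M <= modulus z ->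
    F^`().[z] != 0 /\
    forall w, modulus (w - 1) <= d -> F.[z * w] = F.[z] -> w = 1].
Proof.
have A0 := A_ge0; have K1 := K_ge1.
exists (2 * n%:R * K)^-1, (1 + 4 * K * A).
have n_ge1 : 1 <= n%:R :> R by rewrite ler1n.
have K_gt0 : 0 < K by lra.
have D_gt0 : 0 < 2 * n%:R * K by rewrite mulr_gt0 // mulr_gt0 // ltr0n.
have KA_ge0 : 0 <= K * A by rewrite mulr_ge0 // ltW.
split; [by rewrite invr_gt0|by lra|move=> z le_z].
have z_ge1 : 1 <= modulus z by lra.
have z_neq0 : z != 0 by rewrite -modulus_gt0; lra.
have zV_le1 : (modulus z)^-1 <= 1 by rewrite invf_le1 //; lra.
have le_b : 4 * K * \sum_(j < n) modulus (b z j) <= 1.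
  apply: (@le_trans _ _ (4 * K * (A * (modulus z)^-1))).
    by rewrite ler_wpM2l ?sum_b_le1 //; lra.
  by rewrite mulrA ler_pdivrMr; lra.
have key w : modulus (w - 1) <= (2 * n%:R * K)^-1 ->
    \sum_(j < n.+1) b z j * \sum_(i < j) w ^+ i != 0.
  move=> le_w; rewrite -modulus_eq0 gt_eqF //.
  apply: lt_le_trans (dominant_geom_sum n_gt0 (bn z) _ le_b); first lra.
  by rewrite -ler_pdivlMr // mul1r.
split=> [|w /key key_w /(shift_eq z_neq0)]; last first.
  rewrite (eq_bigr (fun j : 'I_n.+1 => (w - 1) * (b z j * \sum_(i < j) w ^+ i))).
    rewrite -mulr_sumr => /eqP; rewrite mulf_eq0 (negbTE key_w) orbF subr_eq0.
    by move/eqP.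
  by move=> j _; rewrite subrX1 mulrCA.
pose G j : R[i] := \sum_(i < j) 1 ^+ i.
have GE j : G j = j%:R by rewrite /G; under eq_bigr do rewrite expr1n; rewrite sumr_const card_ord.
have := key 1; rewrite subrr modulus0 invr_ge0 (ltW D_gt0) => /(_ isT).
rewrite -[\sum_(j < _) _]/(\sum_(j < n.+1) b z j * G j).
apply: contra_neq => dF0.
have szF' : (size F^`() <= n)%N.
  by rewrite -ltnS -szF lt_size_deriv ?monic_neq0.
have eqG : z ^+ n * (\sum_(j < n.+1) b z j * G j) = z * F^`().[z].
  rewrite (horner_coef_wide z szF') big_ord_recl GE mulr0 add0r !mulr_sumr.
  apply: eq_bigr => -[j /= le_jn] _.
  rewrite coef_deriv /bump /= add1n /b exprVn GE.
  have -> : z ^+ n = z * z ^+ j * z ^+ (n - j.+1).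
    by rewrite -exprS -exprD subnKC.
  rewrite -[F`_j.+1 *+ _]mulr_natr.
  by field; rewrite expf_neq0.
by apply: (mulfI (expf_neq0 n z_neq0)); rewrite eqG dF0 !mulr0.
Qed.

(** All coefficients [b z j] with [j < n] are [O(1 / |z|)], so the equation leaves [w^n - 1] small.
    A [w] with [|w| > 2] is impossible because [w^n] would dominate the other terms. *)
Lemma large_roots_ratio : exists M : R, 0 < M /\
  forall z w, M <= modulus z -> F.[z * w] = F.[z] ->
    modulus w <= 2 /\ modulus (w ^+ n - 1) <= A * 2 ^+ n.+1 / modulus z.
Proof.
have A0 := A_ge0.
exists (1 + 8 * A); split=> [|z w le_z]; first by lra.
have z_ge1 : 1 <= modulus z by lra.
have z_neq0 : z != 0 by rewrite -modulus_gt0; lra.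
have zV_le1 : (modulus z)^-1 <= 1 by rewrite invf_le1 //; lra.
have sum_b := sum_b_le1 zV_le1.
have sum_b8 : 8 * \sum_(j < n) modulus (b z j) <= 1.
  apply: (@le_trans _ _ (8 * (A * (modulus z)^-1))).
    by rewrite ler_wpM2l.
  by rewrite mulrA ler_pdivrMr; lra.
have sum_b_ge0 : 0 <= \sum_(j < n) modulus (b z j).
  by apply: sumr_ge0 => j _; apply: modulus_ge0.
move=> /(shift_eq z_neq0); rewrite big_ord_recr /= bn mul1r => eq0.
have le_wn (B : R) : (forall j : 'I_n, modulus (w ^+ j) + 1 <= B) ->
    modulus (w ^+ n - 1) <= (\sum_(j < n) modulus (b z j)) * B.
  move=> le_B; have -> : w ^+ n - 1 = - \sum_(j < n) b z j * (w ^+ j - 1).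
    by apply/eqP; rewrite -addr_eq0 addrC eq0.
  rewrite modulusN; apply: le_trans (modulus_sum _ _ _) _.
  rewrite mulr_suml; apply: ler_sum => j _.
  rewrite modulusM ler_wpM2l ?modulus_ge0 //.
  by apply: le_trans (modulusB _ _) _; rewrite modulus1.
have w_le2 : modulus w <= 2.
  rewrite leNgt; apply/negP => w_gt2.
  have w_ge1 : 1 <= modulus w by lra.
  have wn_gt2 : 2 < modulus w ^+ n.
    by apply: lt_le_trans w_gt2 _; rewrite ler_eXnr.
  have := le_wn (2 * modulus w ^+ n).
  have := modulusDl (w ^+ n) (- 1); rewrite modulusN modulus1 modulusX => le1.
  have le_j (j : 'I_n) : modulus (w ^+ j) + 1 <= 2 * modulus w ^+ n.
    have : modulus w ^+ j <= modulus w ^+ n by rewrite ler_weXn2l // ltnW.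
    by rewrite modulusX; lra.
  by move=> /(_ le_j); nra.
split=> //.
have := le_wn (2 ^+ n.+1); rewrite exprS.
have le_j (j : 'I_n) : modulus (w ^+ j) + 1 <= 2 * 2 ^+ n.
  have := @modulusX_le2 R w n j (ltnW (ltn_ord j)) w_le2.
  have : (1 : R) <= 2 ^+ n by rewrite exprn_ege1 // ler1n.
  lra.
move=> /(_ le_j) /le_trans; apply.
rewrite mulrAC ler_wpM2r //; apply: mulr_ge0 => //; exact: exprn_ge0.
Qed.

(* With [v = w / om] close to 1 and [s = 1 / z], the equation [F(z w) = F(z)]
   gives [v - 1 = O(s^(n - e))].  In its sum with [F(z / w) = F(z)] the terms of
   exponent above [e] are [O((v - 1)^2)], because [v^j + v^-j - 2] vanishes to
   second order, and so too small to cancel the term of exponent [e]. *)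
Lemma no_large_geometric_triple (om : R[i]) (e : nat) :
  om ^+ n = 1 -> (e < n)%N -> F`_e != 0 -> om ^+ e != 1 ->
  (forall j, (e < j < n)%N -> F`_j != 0 -> om ^+ j = 1) ->
  exists d M : R, [/\ 0 < d, 0 < M & forall z w, M <= modulus z ->
    modulus (w - om) <= d -> F.[z * w] = F.[z] -> F.[z * w^-1] = F.[z] -> False].
Proof.
move=> omn lt_en Fe_neq0 ome_neq1 om_above.
have A0 := A_ge0; have K1 := K_ge1.
have n_ge1 : 1 <= n%:R :> R by rewrite ler1n.
have two_n : 1 <= 2 ^+ n :> R by rewrite exprn_ege1 // ler1n.
pose g := modulus (om ^+ e - 1).
have g_gt0 : 0 < g by rewrite modulus_gt0 subr_eq0.
pose fe := modulus F`_e.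
have fe_gt0 : 0 < fe by rewrite modulus_gt0.
pose C := 8 * 2 ^+ n * A.
pose C1 := 2 * (1 + A) * K ^+ 2 * C ^+ 2 + A * 2 ^+ n * 4.
have C_ge0 : 0 <= C by rewrite mulr_ge0 // mulr_ge0 // exprn_ge0.
have C1_ge0 : 0 <= C1.
  have A1_ge0 : 0 <= 1 + A by lra.
  by rewrite /C1 addr_ge0 // !mulr_ge0 // exprn_ge0 //; lra.
have nK_ge1 : 1 <= n%:R * K by rewrite mulr_ege1.
have Kg_ge0 : 0 <= 2 * K / g by rewrite divr_ge0 ?ltW //; lra.
(* The radius [D^-1] makes [eta] at most [1/2], [1/(2 n K)] and [g/(2 K)] at once. *)
pose D := 2 + 2 * (n%:R * K) + 2 * K / g.
have D_gt0 : 0 < D by rewrite /D; lra.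
have KA_ge0 : 0 <= K * A by rewrite mulr_ge0 //; lra.
have fg_gt0 : 0 < fe * g ^+ 2 by rewrite mulr_gt0 // exprn_gt0.
have q_gt0 : 0 < 4 * 2 ^+ n :> R by lra.
(* Once [|z| > Q], the final upper bound on the term of exponent [e] falls below its lower bound. *)
pose Q := C1 * (4 * 2 ^+ n) / (fe * g ^+ 2).
have Q_ge0 : 0 <= Q.
  by rewrite divr_ge0 ?(ltW fg_gt0) // mulr_ge0 // ltW.
exists D^-1, (1 + 4 * (K * A) + Q); split; [by rewrite invr_gt0|lra|].
move=> z w le_z le_w eq_w eq_wV.
have z_gt0 : 0 < modulus z by lra.
have z_neq0 : z != 0 by rewrite -modulus_gt0.
pose x := (modulus z)^-1.
have x_gt0 : 0 < x by rewrite invr_gt0.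
have x_le1 : x <= 1 by rewrite invf_le1 //; lra.
have xM : x * (1 + 4 * (K * A) + Q) <= 1 by rewrite mulrC ler_pdivrMr // mul1r.
have xKA : 4 * K * (A * x) <= 1.
  have := mulr_ge0 (ltW x_gt0) Q_ge0; lra.
have xQ : x * Q < 1.
  have := mulr_ge0 (ltW x_gt0) KA_ge0; lra.
have om_mod : modulus om = 1.
  apply/eqP; rewrite -(pexpr_eq1 n_gt0) ?modulus_ge0 //.
  by rewrite -modulusX omn modulus1.
have om_neq0 : om != 0 by rewrite -modulus_gt0 om_mod.
have [v vE] : exists v, v = w / om by exists (w / om).
pose eta := modulus (v - 1).
have eta_ge0 : 0 <= eta := modulus_ge0 _.
have etaE : eta = modulus (w - om).
  have -> : w - om = (v - 1) * om by rewrite vE mulrBl mul1r divfK.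
  by rewrite modulusM om_mod mulr1.
have etaD : eta * D <= 1 by rewrite -ler_pdivlMr // mul1r etaE.
have eta2 : eta * 2 <= 1.
  have h1 := mulr_ge0 eta_ge0 Kg_ge0.
  have : 0 <= eta * (n%:R * K) by rewrite mulr_ge0 //; lra.
  by move: etaD; rewrite /D; lra.
have eta_nK : eta * (2 * n%:R * K) <= 1.
  have h1 := mulr_ge0 eta_ge0 Kg_ge0.
  by move: etaD; rewrite /D; lra.
have eta_g : 2 * (K * eta) <= g.
  have : eta * (2 * K / g) <= 1.
    have : 0 <= eta * (n%:R * K) by rewrite mulr_ge0 //; lra.
    by move: etaD; rewrite /D; lra.
  by rewrite mulrA ler_pdivrMr //; lra.
have v_le2 : modulus v <= 2 by apply: modulus_le2_near1; rewrite -/eta; lra.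
have v_ge : 1 / 2 <= modulus v.
  rewrite -[v](subrK 1) addrC; apply: le_trans (modulusDl _ _).
  by rewrite modulus1 -/eta; lra.
have v_gt0 : 0 < modulus v by lra.
have v_neq0 : v != 0 by rewrite -modulus_gt0.
have wE : w = v * om by rewrite vE divfK.
have w_neq0 : w != 0 by rewrite wE mulf_neq0.
have w_le2 : modulus w <= 2 by rewrite wE modulusM om_mod mulr1.
have vV_le2 : modulus v^-1 <= 2.
  by rewrite modulusV -[2]invrK lef_pV2 ?posrE ?invr_gt0 //; lra.
have wV_le2 : modulus w^-1 <= 2.
  by rewrite wE invfM modulusM [modulus om^-1]modulusV om_mod invr1 mulr1.
have etaV : modulus (v^-1 - 1) <= 2 * eta.
  have -> : v^-1 - 1 = v^-1 * (1 - v) by rewrite mulrBr mulr1 mulVf.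
  by rewrite modulusM modulusBC -/eta ler_wpM2r.
have om_b j : (e < j < n.+1)%N -> b z j * om ^+ j = b z j.
  move=> /andP[lt_ej]; rewrite ltnS leq_eqVlt => /predU1P[->|lt_jn].
    by rewrite omn mulr1.
  have [Fj0|/om_above -> //] := eqVneq F`_j 0; first by rewrite /b Fj0 !mul0r.
    by rewrite mulr1.
  by rewrite lt_ej.
have om_bV j : (e < j < n.+1)%N -> b z j * om ^- j = b z j.
  by move=> /om_b {1}<-; rewrite mulfK // expf_neq0.
have eqV := shift_eq z_neq0 eq_wV; have {}eq_w := shift_eq z_neq0 eq_w.
pose X := x ^+ (n - e).
have X_gt0 : 0 < X by rewrite exprn_gt0.
have X_lex : X <= x.
  by rewrite /X -[leRHS]expr1 ler_wiXn2l ?subn_gt0 // ltW.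
have sum_le : \sum_(j < n | (j <= e)%N) modulus (b z j) <= A * X.
  by apply: sum_b_le => // j le_je; rewrite leq_sub2l.
have sum_lt : \sum_(j < n | (j < e)%N) modulus (b z j) <= A * (X * x).
  rewrite -exprSr; apply: sum_b_le => // j lt_je.
  by move: (nat_of_ord j) lt_je lt_en => m; clear; lia.
have sum_gt : \sum_(j < n | (e < j)%N) modulus (b z j) <= A * x.
  by rewrite -[x]expr1; apply: sum_b_le => // j _; rewrite subn_gt0.
(* In exponents above [e], [om] disappears and [v] replaces [w]. The factor [v - 1] comes out of
   these terms with a cofactor of modulus at least 1/4, and the terms of exponent at most [e] are
   [O(X)]. *)
have le_eta : eta <= C * X.
  pose c j := if (e < j)%N then b z j else 0.
  have cE : c n = 1 by rewrite /c lt_en bn.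
  have le_c : 4 * K * \sum_(j < n) modulus (c j) <= 1.
    have K4 : 0 <= 4 * K by rewrite mulr_ge0 // (le_trans ler01).
    apply: le_trans xKA; rewrite ler_wpM2l //.
    apply: le_trans sum_gt; rewrite [leRHS]big_mkcond /=.
    by apply: ler_sum => j _; rewrite /c; case: ifP; rewrite ?modulus0.
  have dom := dominant_geom_sum n_gt0 cE eta_nK le_c.
  have : (v - 1) * \sum_(j < n.+1) c j * \sum_(i < j) v ^+ i =
         - \sum_(j < n | (j <= e)%N) b z j * (w ^+ j - 1).
    apply/eqP; rewrite -addr_eq0; apply/eqP.
    have -> : \sum_(j < n | (j <= e)%N) b z j * (w ^+ j - 1) =
      \sum_(j < n.+1) if (j <= e)%N then b z j * (w ^+ j - 1) else 0.
      by rewrite big_ord_recr /= leqNgt lt_en addr0 big_mkcond.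
    rewrite mulr_sumr -big_split -[RHS]eq_w /=.
    apply: eq_bigr => -[j lt_j] _ /=; rewrite /c ltnNge.
    case: leqP => [|lt_ej] /=; first by rewrite mul0r mulr0 add0r.
    rewrite addr0 mulrCA -subrX1 wE exprMn !mulrBr !mulr1; congr (_ - _).
    by rewrite mulrCA om_b ?lt_ej // mulrC.
  move/(congr1 (@modulus R)); rewrite modulusM modulusN -/eta => eq_mod.
  have : eta / 4 <= A * X * (2 * 2 ^+ n).
    apply: (@le_trans _ _ (eta * modulus
      (\sum_(j < n.+1) c j * \sum_(i < j) v ^+ i))); first by rewrite ler_wpM2l.
    rewrite eq_mod; apply: le_trans (modulus_sum _ _ _) _.
    apply: (@le_trans _ _ ((\sum_(j < n | (j <= e)%N) modulus (b z j)) * (2 * 2 ^+ n))).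
      rewrite mulr_suml; apply: ler_sum => j _; rewrite modulusM.
      rewrite ler_wpM2l ?modulus_ge0 //; apply: le_trans (modulusB _ _) _.
      rewrite modulus1; have := @modulusX_le2 R w n j (ltnW (ltn_ord j)) w_le2.
      by lra.
    by rewrite ler_wpM2r // mulr_ge0 // exprn_ge0.
  by rewrite /C; lra.
(* The equations for [w] and [w^-1] are added; [f j] is the factor of [b z j] in the sum. *)
pose f j := w ^+ j + w^-1 ^+ j - 2.
have fE j : f j = (w ^+ j - 1) * (1 - w^-1 ^+ j).
  by rewrite /f exprVn; field; rewrite expf_neq0.
have eq_f : \sum_(j < n.+1) b z j * f j = 0.
  transitivity (\sum_(j < n.+1) b z j * (w ^+ j - 1) +
                \sum_(j < n.+1) b z j * (w^-1 ^+ j - 1)); last first.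
    by rewrite eq_w eqV addr0.
  by rewrite -big_split /=; apply: eq_bigr => j _; rewrite /f; ring.
have le_f j : (j <= n)%N -> modulus (f j) <= 4 * 2 ^+ n.
  move=> le_jn; apply: le_trans (modulusB _ _) _.
  have := modulusD (w ^+ j) (w^-1 ^+ j).
  have := modulusX_le2 le_jn w_le2; have := modulusX_le2 le_jn wV_le2.
  by rewrite modulus_nat; lra.
have le_bf j : (e < j < n.+1)%N ->
    modulus (b z j * f j) <= modulus (b z j) * (2 * K ^+ 2 * eta ^+ 2).
  move=> Hj; have le_jn : (j <= n)%N by move: Hj => /andP[].
  have -> : b z j * f j = b z j * ((v ^+ j - 1) * (1 - v^-1 ^+ j)).
    have -> : (v ^+ j - 1) * (1 - v^-1 ^+ j) = v ^+ j + v^-1 ^+ j - 2.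
      by rewrite exprVn; field; rewrite expf_neq0.
    rewrite /f wE invfM !exprMn !mulrBr !mulrDr; congr (_ + _ - _).
      by rewrite mulrCA om_b // mulrC.
    by rewrite mulrCA [om^-1 ^+ _]exprVn om_bV // mulrC.
  rewrite modulusM ler_wpM2l ?modulus_ge0 // modulusM.
  have -> : 2 * K ^+ 2 * eta ^+ 2 = (K * eta) * (K * (2 * eta)) by ring.
  rewrite ler_pM ?modulus_ge0 //; first exact: modulus_subX1_le.
  rewrite modulusBC; apply: le_trans (modulus_subX1_le le_jn vV_le2) _.
  by apply: ler_wpM2l etaV; apply: le_trans ler01 K1.
have eq_be : b z e * f e = - (b z n * f n +
   (\sum_(j < n | (e < j)%N) b z j * f j + \sum_(j < n | (j < e)%N) b z j * f j)).
  apply/eqP; rewrite -addr_eq0 -[X in _ == X]eq_f big_ord_recr /=; apply/eqP.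
  rewrite addrCA [LHS]addrC; congr (_ + _).
  rewrite [RHS](bigD1 (Ordinal lt_en)) //=; congr (_ + _).
  rewrite [RHS](bigID (fun j : 'I_n => (e < j)%N)) /=.
  by congr (_ + _); apply: eq_bigl => j; rewrite -val_eqE /= -?leqNgt;
    move: (nat_of_ord j); clear; lia.
have le_be : modulus (b z e * f e) <=
    (1 + A) * (2 * K ^+ 2 * eta ^+ 2) + A * (X * x) * (4 * 2 ^+ n).
  have K2_ge0 : 0 <= 2 * K ^+ 2 * eta ^+ 2 by rewrite !mulr_ge0 ?exprn_ge0 //; lra.
  rewrite eq_be modulusN mulrDl mul1r -addrA.
  apply: le_trans (modulusD _ _) _; apply: lerD.
    by have := le_bf n; rewrite lt_en ltnSn bn modulus1 !mul1r => /(_ isT).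
  apply: le_trans (modulusD _ _) _; apply: lerD.
    apply: le_trans (modulus_sum _ _ _) _.
    apply: (@le_trans _ _ (A * x * (2 * K ^+ 2 * eta ^+ 2))).
      apply: le_trans (ler_wpM2r K2_ge0 sum_gt); rewrite mulr_suml.
      by apply: ler_sum => j lt_ej; apply: le_bf; rewrite lt_ej ltnS ltnW.
    by rewrite ler_wpM2r // ler_piMr.
  apply: le_trans (modulus_sum _ _ _) _.
  have two_ge0 : 0 <= 4 * 2 ^+ n :> R by lra.
  apply: le_trans (ler_wpM2r two_ge0 sum_lt); rewrite mulr_suml.
  apply: ler_sum => j _; rewrite modulusM ler_wpM2l ?modulus_ge0 //.
  by rewrite le_f // ltnW.
(* [f e] equals [(w^e - 1)^2 / w^e], and [w^e] stays at distance at least [g / 2] from 1. *)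
have ge_fe : g ^+ 2 / (4 * 2 ^+ n) <= modulus (f e).
  have ge_we : g / 2 <= modulus (w ^+ e - 1).
    have -> : w ^+ e - 1 = (om ^+ e - 1) + (v ^+ e - 1) * om ^+ e.
      by rewrite wE exprMn; ring.
    apply: le_trans (modulusDl _ _); rewrite modulusM modulusX om_mod expr1n mulr1.
    by have := modulus_subX1_le (ltnW lt_en) v_le2; rewrite -/g -/eta -/K; lra.
  have -> : f e = (w ^+ e - 1) ^+ 2 / w ^+ e.
    by rewrite fE exprVn; field; rewrite expf_neq0.
  rewrite modulusM modulusV [modulus (_ ^+ 2)]modulusX invfM mulrA.
  apply: ler_pM.
  - by rewrite divr_ge0 // exprn_ge0 // ltW.
  - by rewrite invr_ge0 exprn_ge0.
  - have -> : g ^+ 2 / 4 = (g / 2) ^+ 2 by field.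
    by rewrite lerXn2r ?nnegrE ?modulus_ge0 ?divr_ge0 // ltW.
  rewrite lef_pV2 ?posrE ?modulus_gt0 ?expf_neq0 ?(lt_le_trans ltr01) //.
  exact: modulusX_le2 (ltnW lt_en) w_le2.
have le1 : fe * X * (g ^+ 2 / (4 * 2 ^+ n)) <= modulus (b z e * f e).
  by rewrite modulusM modulus_b ler_wpM2l // mulr_ge0 ?ltW.
(* As [e < n] gives [X <= x], the square of [eta] carries an extra factor [x] compared with the term
   of exponent [e]. *)
have eta2_le : eta ^+ 2 <= C ^+ 2 * (X * x).
  apply: (@le_trans _ _ ((C * X) ^+ 2)).
    have CX_ge0 : 0 <= C * X := mulr_ge0 C_ge0 (ltW X_gt0).
    by rewrite lerXn2r.
  rewrite exprMn; apply: ler_wpM2l; first exact: exprn_ge0.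
  by rewrite expr2; apply: ler_wpM2l X_lex; apply: ltW.
have le2 : modulus (b z e * f e) <= X * x * C1.
  apply: le_trans le_be _.
  have -> : X * x * C1 = (1 + A) * (2 * K ^+ 2 * (C ^+ 2 * (X * x))) +
    A * (X * x) * (4 * 2 ^+ n) by rewrite /C1; ring.
  rewrite lerD2r ler_wpM2l //; first lra.
  by rewrite ler_wpM2l // mulr_ge0 // exprn_ge0 //; lra.
have lt3 : x * C1 < fe * (g ^+ 2 / (4 * 2 ^+ n)).
  rewrite mulrA ltr_pdivlMr // -mulrA.
  have QE : x * Q = (x * (C1 * (4 * 2 ^+ n))) / (fe * g ^+ 2) by exact: mulrA.
  by move: xQ; rewrite QE ltr_pdivrMr // mul1r.
have := le_trans le1 le2.
have -> : fe * X * (g ^+ 2 / (4 * 2 ^+ n)) = X * (fe * (g ^+ 2 / (4 * 2 ^+ n))).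
  by ring.
by rewrite -[X * x * C1]mulrA ler_pM2l // leNgt lt3.
Qed.

End Asymptotics.

(** * Families [F + t] in which every member has a geometric triple of roots *)

Section DegenerateFamilies.
Variable R : realType.

(** At the head of the list the derivative is the value of the remaining product, which vanishes if
    the head occurs again. *)
Lemma uniq_simple_roots (s : seq R[i]) :
  (forall z, z \in s -> (\prod_(w <- s) ('X - w%:P))^`().[z] != 0) -> uniq s.
Proof.
elim: s => //= z s ihs simple.
have simpleE y : (\prod_(w <- z :: s) ('X - w%:P))^`().[y] =
    (\prod_(w <- s) ('X - w%:P)).[y] + (y - z) * (\prod_(w <- s) ('X - w%:P))^`().[y].
  by rewrite big_cons derivM derivXsubC mul1r hornerD hornerM hornerXsubC.
apply/andP; split.
  have := simple z (mem_head _ _); rewrite simpleE subrr mul0r addr0.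
  by rewrite -[_ != 0]/(~~ root _ _) root_prod_XsubC.
apply: ihs => y ys; have := simple y; rewrite inE ys orbT simpleE => /(_ isT).
have /rootP -> : root (\prod_(w <- s) ('X - w%:P)) y by rewrite root_prod_XsubC.
by rewrite add0r mulf_eq0 negb_or => /andP[].
Qed.

Lemma modulus_horner_le (F : {poly R[i]}) (z : R[i]) (M : R) :
  1 <= M -> modulus z <= M ->
  modulus F.[z] <= (\sum_(j < size F) modulus F`_j) * M ^+ size F.
Proof.
move=> M_ge1 le_z; rewrite horner_coef mulr_suml.
apply: le_trans (modulus_sum _ _ _) _; apply: ler_sum => j _.
rewrite modulusM ler_wpM2l ?modulus_ge0 // modulusX.
apply: (@le_trans _ _ (M ^+ j)).
  by rewrite lerXn2r ?nnegrE ?modulus_ge0 ?(le_trans ler01).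
by rewrite ler_weXn2l // ltnW.
Qed.

Lemma near_some_root (s : seq R[i]) (w : R[i]) (d : R) : 0 < d ->
  modulus (\prod_(y <- s) ('X - y%:P)).[w] < d ^+ size s ->
  exists2 y, y \in s & modulus (w - y) <= d.
Proof.
move=> d_gt0; elim: s => [|y s ihs].
  by rewrite big_nil hornerC modulus1 ltxx.
rewrite big_cons hornerM hornerXsubC modulusM /= exprS => lt_w.
have [le_d|gt_d] := leP (modulus (w - y)) d; first by exists y; rewrite ?mem_head.
have [|y' sy' le_y'] := ihs; last by exists y'; rewrite // inE sy' orbT.
rewrite ltNge; apply/negP => ge_d; move: lt_w; rewrite ltNge => /negP; apply.
by rewrite ler_pM ?exprn_ge0 // ltW.
Qed.

(** A finite list admits a common radius, the least one, and a common threshold, the largest one. *)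
Lemma uniform_radii (s : seq R[i]) (P : R[i] -> R -> R -> Prop) :
  (forall y d d' M M', P y d M -> d' <= d -> M <= M' -> P y d' M') ->
  (forall y, y \in s -> exists d M, 0 < d /\ P y d M) ->
  exists d M, 0 < d /\ forall y, y \in s -> P y d M.
Proof.
move=> mono; elim: s => [|y s ihs] exP; first by exists 1, 0.
have [d1 [M1 [d1_gt0 P1]]] := exP y (mem_head _ _).
have [|d2 [M2 [d2_gt0 P2]]] := ihs.
  by move=> x xs; apply: exP; rewrite inE xs orbT.
exists (Num.min d1 d2), (Num.max M1 M2); split; first by rewrite lt_min d1_gt0.
move=> x; rewrite inE => /predU1P[->|/P2 Px].
  by apply: mono P1 _ _; rewrite ?ge_min ?le_max lexx.
by apply: mono Px _ _; rewrite ?ge_min ?le_max lexx orbT.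
Qed.

(** Positions are required to differ, not values, so a multiple root can fill several places. *)
Definition has_geometric_triple (s : seq R[i]) : Prop :=
  exists i j k : nat, [/\ (i < size s)%N, (j < size s)%N, (k < size s)%N,
    [/\ i != j, i != k & j != k] & s`_i ^+ 2 = s`_j * s`_k].

(** For large [t] the ratio [w] of two roots of a triple is close to an [n]-th root of unity [y]. If
    no such [y] has order at least 3 and equals 1 at all exponents of [F], then [w^2 = 1] is forced,
    and two roots at distinct positions coincide although all roots are simple. *)
Lemma geometric_triples_degenerate (n : nat) (F : {poly R[i]}) :
  (0 < n)%N -> F \is monic -> size F = n.+1 ->
  (forall t : nat, has_geometric_triple (croots (F + t%:R%:P))) ->
  exists2 m, (3 <= m)%N &
    forall j, (0 < j <= n)%N -> F`_j != 0 -> (m %| j)%N.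
Proof.
move=> n_gt0 mF szF triples.
have mW : ('X^n - 1 : {poly R[i]}) \is monic by rewrite monicXnsubC.
have szW : size (croots ('X^n - 1 : {poly R[i]})) = n.
  by rewrite size_croots // size_XnsubC.
set W := croots _ in szW.
have WE : \prod_(y <- W) ('X - y%:P) = 'X^n - 1 by rewrite -croots_monic.
have memW y : y \in W -> y ^+ n = 1.
  rewrite mem_croots // rootE !hornerE subr_eq0 => /eqP.
  by rewrite ?hornerXn.
(* The order of a good [y] is the [m] sought: it does not divide 2, and it divides every exponent of
   [F]. The other case is refuted. *)
pose good (y : R[i]) := (y ^+ 2 != 1) &&
  [forall j : 'I_n, (F`_j != 0) ==> (y ^+ j == 1)].
have [/hasP[om /memW omn /andP[om2 /forallP om_j]]|/hasPn no_good] := boolP (has good W).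
  have [m prim_om m_dvd_n] := prim_order_exists n_gt0 omn.
  exists m; last first.
    move=> j /andP[j_gt0]; rewrite leq_eqVlt => /predU1P[->//|lt_jn] Fj.
    by rewrite (prim_order_dvd prim_om); have /implyP := om_j (Ordinal lt_jn); apply.
  have m_gt0 := prim_order_gt0 prim_om.
  have : ~~ (m %| 2)%N by rewrite (prim_order_dvd prim_om).
  by case: m m_gt0 {prim_om m_dvd_n} => [|[|[|m]]].
exfalso.
have [d0 [M0 [d0_gt0 M0_gt0 sep]]] := large_roots_separated n_gt0 mF szF.
have [M1 [M1_gt0 ratio]] := large_roots_ratio n_gt0 mF szF.
pose P (y : R[i]) (d M : R) := forall z w, M <= modulus z -> w != 0 ->
  modulus w <= 2 -> modulus (w - y) <= d -> F.[z * w] = F.[z] ->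
  F.[z * w^-1] = F.[z] -> w ^+ 2 = 1.
have [d [M [d_gt0 PW]]] : exists d M, 0 < d /\ forall y, y \in W -> P y d M.
  apply: uniform_radii => [y d d' M M' Py le_d le_M z w le_z w0 w2 le_w|y Wy].
    by apply: Py => //; [apply: le_trans le_z|apply: le_trans le_d].
  have /memW yn := Wy.
  have y_mod : modulus y = 1.
    apply/eqP; rewrite -(pexpr_eq1 n_gt0) ?modulus_ge0 //.
    by rewrite -modulusX yn modulus1.
  have := no_good _ Wy; rewrite negb_and negbK => /orP[/eqP y2|].
    (* Here [z / w] and [z w] have ratio [w^2] close to 1, so they coincide by separation. The 3
       bounds [|w + y|], and [2 * M0] ensures [|z / w| >= M0]. *)
    exists (d0 / 3), (2 * M0); split; first by rewrite divr_gt0.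
    move=> z w le_z w0 w2 le_w eqw eqwV.
    have := sep (z * w^-1) _ => -[|_ /(_ (w ^+ 2))]; last first.
      apply; last by rewrite expr2 mulrA divfK // eqw eqwV.
      have -> : w ^+ 2 - 1 = (w - y) * (w + y) by rewrite -y2; ring.
      rewrite modulusM; have le3 := modulusD w y.
      have -> : d0 = d0 / 3 * 3 by field.
      by rewrite ler_pM ?modulus_ge0 //; lra.
    rewrite modulusM modulusV ler_pdivlMr ?modulus_gt0 //.
    by apply: le_trans le_z; rewrite mulrC ler_wpM2r // ltW.
  rewrite negb_forall => /existsP[j]; rewrite negb_imply => /andP[Fj yj].
  (* The largest exponent of [F] at which [y] is not 1 is the [e] required by
     [no_large_geometric_triple]. *)
  pose bad e := [&& (e < n)%N, F`_e != 0 & y ^+ e != 1].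
  have ex_bad : exists e, bad e by exists j; rewrite /bad ltn_ord Fj.
  have bad_le e : bad e -> (e <= n)%N by case/andP => /ltnW.
  case: (ex_maxnP ex_bad bad_le) => e /and3P[lt_en Fe ye] max_e.
  have [j' /andP[lt_ej lt_jn] Fj'|d [M [d_gt0 _ contra]]] :=
    no_large_geometric_triple n_gt0 mF szF yn lt_en Fe ye.
    apply/eqP; apply: contraTT lt_ej => yj'.
    by rewrite -leqNgt max_e // /bad lt_jn Fj'.
  exists d, M; split=> // z w le_z _ _ le_w eqw eqwV.
  by have := contra z w le_z le_w eqw eqwV.
pose A := \sum_(j < n) modulus F`_j.
have A_ge0 : 0 <= A by apply: sumr_ge0 => i _; apply: modulus_ge0.
(* Beyond [M2], [large_roots_ratio] gives [|w^n - 1| < d^n], so [w] lies within [d] of an [n]-th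
   root of unity. *)
pose M2 := 2 * A * 2 ^+ n.+1 / d ^+ n.
have M2_ge0 : 0 <= M2 by rewrite divr_ge0 ?exprn_ge0 ?mulr_ge0 ?exprn_ge0 // ltW.
pose M' := 1 + M0 + M1 + M2 + Num.max M 0.
have max_ge0 : 0 <= Num.max M 0 by rewrite le_max lexx orbT.
have M'_M : M <= M'.
  have : M <= Num.max M 0 by rewrite le_max lexx.
  by rewrite /M'; lra.
have M'_ge1 : 1 <= M' by rewrite /M'; lra.
(* [B] bounds [F] on the disc of radius [M'], so for [t > B] all roots of [F + t] lie outside it. *)
pose B := (\sum_(j < size F) modulus F`_j) * M' ^+ size F.
have B_ge0 : 0 <= B.
  apply: mulr_ge0; first by apply: sumr_ge0 => i _; apply: modulus_ge0.
  by apply: exprn_ge0; apply: le_trans ler01 M'_ge1.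
pose t := Num.bound B; have lt_Bt : B < t%:R by apply: archi_boundP.
have {triples} := triples t; set s := croots (F + t%:R%:P) => triple.
have szt : size (F + t%:R%:P) = n.+1.
  by rewrite size_polyDl // size_polyC szF; case: (_ != 0).
have mt : F + t%:R%:P \is monic.
  rewrite monicE /lead_coef szt coefD coefC eqn0Ngt n_gt0 addr0.
  by move: mF; rewrite monicE /lead_coef szF.
have sE : \prod_(y <- s) ('X - y%:P) = F + t%:R%:P by rewrite -croots_monic.
have mem_s y : y \in s -> F.[y] = - t%:R.
  by rewrite mem_croots // rootE hornerD hornerC addr_eq0 => /eqP.
have large y : y \in s -> M' <= modulus y.
  move=> /mem_s Fy; rewrite leNgt; apply/negP => /ltW /(modulus_horner_le F M'_ge1).
  by rewrite Fy modulusN modulus_nat leNgt lt_Bt.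
have uniq_s : uniq s.
  apply: uniq_simple_roots => y /large le_y; rewrite sE derivD derivC addr0.
  by have [] := sep y; first by move: le_y; rewrite /M'; lra.
have [i [j [k [lti ltj ltk [_ _ neq_jk] eq_sqr]]]] := triple.
have [si sj sk] : [/\ s`_i \in s, s`_j \in s & s`_k \in s] by rewrite !mem_nth.
have nz y : y \in s -> y != 0.
  by move=> /large le_y; rewrite -modulus_gt0; apply: lt_le_trans le_y; lra.
pose w := s`_j / s`_i.
have zw : s`_i * w = s`_j by rewrite mulrC divfK ?nz.
have zwV : s`_i * w^-1 = s`_k.
  by rewrite invf_div mulrA -expr2 eq_sqr mulrAC mulfV ?nz ?mul1r.
have w0 : w != 0 by rewrite mulf_neq0 ?invr_eq0 ?nz.
have eqw : F.[s`_i * w] = F.[s`_i] by rewrite zw !mem_s.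
have eqwV : F.[s`_i * w^-1] = F.[s`_i] by rewrite zwV !mem_s.
have le_i := large _ si.
have [w2 wn] : modulus w <= 2 /\ modulus (w ^+ n - 1) <= A * 2 ^+ n.+1 / modulus s`_i.
  by apply: ratio => //; move: le_i; rewrite /M'; lra.
have [y Wy le_wy] : exists2 y, y \in W & modulus (w - y) <= d.
  apply: near_some_root => //; rewrite WE szW !hornerE ?hornerXn.
  apply: le_lt_trans wn _.
  have i_gt0 : 0 < modulus s`_i by rewrite modulus_gt0 nz.
  have dn_gt0 : 0 < d ^+ n by rewrite exprn_gt0.
  have le_M2 : M2 < modulus s`_i by move: le_i; rewrite /M'; lra.
  move: le_M2; rewrite /M2 ltr_pdivrMr // ltr_pdivrMr // => lt_M2.
  have : 0 <= A * 2 ^+ n.+1 by rewrite mulr_ge0 ?exprn_ge0.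
  by lra.
have w_sqr : w ^+ 2 = 1 by apply: (PW _ Wy s`_i) => //; apply: le_trans le_i.
have : s`_j = s`_k by rewrite -zw -zwV; congr (_ * _); apply: (mulIf w0); rewrite mulVf // -expr2.
by move/eqP; rewrite nth_uniq // (negbTE neq_jk).
Qed.

End DegenerateFamilies.

(** * Geometric triples as an algebraic condition on the constant coefficient *)

Section TriplePolynomial.
Variable R : realType.

Lemma size_prod_lin (n : nat) (V : 'I_n -> {poly R[i]}) (m : 'I_n -> nat) :
  (forall i, (size (V i) <= 2)%N) ->
  (size (\prod_i V i ^+ m i)%R <= (\sum_i m i).+1)%N.
Proof.
move=> szV; elim/big_rec2: _ => [|i a p _ szp]; first by rewrite size_poly1.
apply: leq_trans (size_polyMleq _ _) _.
have szVi : (size (V i ^+ m i) <= (m i).+1)%N.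
  apply: leq_trans (size_poly_exp_leq _ _) _; rewrite ltnS.
  by rewrite -[leqRHS]mul1n leq_mul2r; have := szV i; case: (size _) => [|[|[]]] //; rewrite orbT.
move: szVi szp; set a1 := size (V i ^+ m i); set a2 := size p.
by move: (m i) => b; clear; lia.
Qed.

Definition distinct3 (n : nat) (p : 'I_n * 'I_n * 'I_n) : bool :=
  [&& p.1.1 != p.1.2, p.1.1 != p.2 & p.1.2 != p.2].

Definition triple_mpoly (n : nat) : {mpoly R[i][n]} :=
  \prod_(p : 'I_n * 'I_n * 'I_n | distinct3 p)
    ('X_(p.1.1) ^+ 2 - 'X_(p.1.2) * 'X_(p.2)).

Lemma msymXU (n : nat) (s : 'S_n) (i : 'I_n) :
  msym s ('X_i : {mpoly R[i][n]}) = 'X_(s i).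
Proof.
rewrite msymX; congr ('X_[_]); apply/mnmP => j.
by rewrite mnmE !mnm1E -(inj_eq (@perm_inj _ s)) permKV.
Qed.

(** A permutation of the variables only permutes the triples indexing the product. *)
Lemma triple_mpoly_sym (n : nat) : triple_mpoly n \is symmetric.
Proof.
apply/issymP => s; rewrite rmorph_prod /=.
pose h (p : 'I_n * 'I_n * 'I_n) := ((s p.1.1, s p.1.2), s p.2).
have h_inj : injective h by move=> [[i j] k] [[i' j'] k'] [] /perm_inj -> /perm_inj -> /perm_inj ->.
rewrite /triple_mpoly [RHS](reindex_inj h_inj) /=.
apply: eq_big => [[[i j] k]|[[i j] k] _] /=.
  by rewrite /distinct3 /= !(inj_eq perm_inj).
by rewrite rmorphB rmorphXn rmorphM /= !msymXU.
Qed.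

Lemma triple_mpoly_eq0 (n : nat) (s : n.-tuple R[i]) :
  (triple_mpoly n).@[tnth s] = 0 <-> has_geometric_triple s.
Proof.
rewrite rmorph_prod /=; split=> [/eqP|[i [j [k [lti ltj ltk [ij ik jk] eq_sqr]]]]].
  rewrite prodf_seq_eq0 => /hasP[[[i j] k] _ /= /andP[/and3P[/= ij ik jk]]].
  rewrite rmorphB rmorphXn rmorphM /= !mevalXU subr_eq0 => /eqP eq_sqr.
  exists i, j, k; rewrite !size_tuple !ltn_ord -!tnth_nth; split=> //.
move: lti ltj ltk; rewrite size_tuple => lti ltj ltk.
rewrite (bigD1 ((Ordinal lti, Ordinal ltj), Ordinal ltk)) /=; last first.
  by rewrite /distinct3 -!val_eqE /= ij ik jk.
rewrite rmorphB rmorphXn rmorphM /= !mevalXU !(tnth_nth 0) /=.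
by rewrite eq_sqr subrr mul0r.
Qed.

(* The product over all triples of positions is symmetric in the roots, hence a
   fixed polynomial in the coefficients, of bounded degree in the constant one. *)
Lemma triple_poly (n : nat) : exists D : nat, forall F : {poly R[i]},
  (0 < n)%N -> F \is monic -> size F = n.+1 ->
  exists2 q : {poly R[i]}, (size q <= D)%N &
    forall t, q.[t] = 0 <-> has_geometric_triple (croots (F + t%:P)).
Proof.
have [T [TE _]] := sym_fundamental (triple_mpoly_sym n).
(* The bound comes from [T], which depends on [n] alone and not on [F]. *)
exists (msize T) => F n_gt0 mF szF.
(* [V i] is the elementary symmetric function of degree [i + 1] of the roots of [F + t], as a
   polynomial in [t]; only the product of all the roots involves [t]. *)
pose V (i : 'I_n) : {poly R[i]} := (-1) ^+ i.+1 *: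
  ((F`_(n - i.+1)%N)%:P + (if (n - i.+1 == 0)%N then 'X else 0)).
exists (\sum_(m <- msupp T) T@_m *: \prod_i V i ^+ m i).
  apply: leq_trans (size_sum _ _ _) _; apply/bigmax_leqP_seq => m Tm _.
  apply: leq_trans (size_scale_leq _ _) _.
  apply: leq_trans (msize_mdeg_lt Tm); rewrite mdegE; apply: size_prod_lin => i.
  apply: leq_trans (size_scale_leq _ _) _.
  apply: leq_trans (size_polyD _ _) _; rewrite geq_max size_polyC.
  by case: (_ != 0); case: ifP => _; rewrite ?size_polyX ?size_poly0.
move=> t; have szt : size (F + t%:P) = n.+1.
  by rewrite size_polyDl // size_polyC szF; case: (_ != 0).
have mt : F + t%:P \is monic.
  rewrite monicE /lead_coef szt coefD coefC eqn0Ngt n_gt0 addr0.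
  by move: mF; rewrite monicE /lead_coef szF.
have szs : size (croots (F + t%:P)) == n by rewrite size_croots // szt.
pose s := Tuple szs.
rewrite -[croots _]/(tval s) -triple_mpoly_eq0 -TE comp_mpoly_meval mevalE.
rewrite horner_sum /=.
suff -> : \sum_(m <- msupp T) (T@_m *: \prod_i V i ^+ m i).[t] =
  \sum_(m <- msupp T) T@_m * \prod_i (tnth [tuple mesym n R[i] i.+1 | i < n] i).@[tnth s] ^+ m i.
  by [].
apply: eq_bigr => m _; rewrite hornerZ horner_prod; congr (_ * _).
apply: eq_bigr => i _; rewrite horner_exp; congr (_ ^+ _).
have ltSi : (i.+1 < n.+1)%N by rewrite ltnS.
have := mroots_coeff s (Ordinal ltSi); rewrite -croots_monic //= => eq_c.
rewrite tnth_mktuple /V hornerZ.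
have -> : ((F`_(n - i.+1)%N)%:P + (if (n - i.+1 == 0)%N then 'X else 0)).[t] =
    (F + t%:P)`_(n - i.+1).
  rewrite hornerD hornerC coefD coefC; congr (_ + _).
  by case: ifP; rewrite ?hornerX ?horner0.
by rewrite eq_c mulrA -exprD addnn -signr_odd odd_double mul1r.
Qed.

End TriplePolynomial.

(** * For odd [k], the roots of maximal modulus contain a geometric triple *)

Section RealRoot.
Variable R : realType.
Local Notation toC := (int_to_cpoly R).
Implicit Types s t : seq R[i].

Lemma geometric_triple_perm s t (x y w : R[i]) :
  perm_eq s [:: x, y, w & t] -> x ^+ 2 = y * w -> has_geometric_triple s.
Proof.
rewrite perm_sym => /(perm_iotaP 0)[Is pIs eqs] eq_sqr.
have uIs : uniq Is by rewrite (perm_uniq pIs) iota_uniq.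
have ltIs i : i \in Is -> (i < size s)%N by rewrite (perm_mem pIs) mem_iota.
case: Is {pIs} eqs uIs ltIs => [|i [|j [|k Is]]] //= [xE yE wE _].
rewrite {}xE {}yE {}wE in eq_sqr; rewrite !inE !negb_or => /and3P[/and3P[ij ik _] /andP[jk _] _] ltIs.
by exists i, j, k; split; rewrite ?ltIs ?inE ?eqxx ?orbT.
Qed.

Lemma croots_conj (f : {poly int}) : f \is monic ->
  perm_eq (map conjc (croots (toC f))) (croots (toC f)).
Proof.
move=> mf; apply: prod_XsubC_eq.
have mp : toC f \is monic by rewrite monic_toC.
rewrite -(croots_monic mp).
transitivity (map_poly conjc (toC f)).
  rewrite {2}(croots_monic mp) rmorph_prod big_map; apply: eq_bigr => z _.
  by rewrite rmorphB /= map_polyX map_polyC.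
by apply/polyP => i; rewrite !coef_map /= rmorph_int.
Qed.

Lemma real_sqr_modulus (x : R[i]) : complex.Im x = 0 -> x ^+ 2 = (modulus x ^+ 2)%:C.
Proof. by case: x => a b /= ->; rewrite modulusR real_normK ?num_real ?rmorphXn. Qed.

(** By parity there is a real [x], with [x^2 = r^2]. A nonreal [z] gives [z] times its conjugate
    equal to [r^2]. If all entries are real they are [r] or [-r], so two of the first three agree
    and have product [r^2]. *)
Lemma conj_closed_triple t (r : R) : perm_eq (map conjc t) t ->
  odd (size t) -> (3 <= size t)%N -> (forall z, z \in t -> modulus z = r) ->
  exists x y w t', perm_eq t [:: x, y, w & t'] /\ x ^+ 2 = y * w.
Proof.
move=> conj_t odd_t sz_t mod_t.
have [nreal|all_real] := boolP (has (fun z => complex.Im z != 0) t); last first.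
  have sqr_t z : z \in t -> (z == r%:C) || (z == - r%:C).
    move=> tz; have /hasPn/(_ z tz) := all_real; rewrite negbK => /eqP Im0.
    by rewrite -eqf_sqr (real_sqr_modulus Im0) mod_t // rmorphXn.
  case: t sz_t sqr_t {conj_t odd_t mod_t all_real} => [|a [|b [|c t]]] //= _ sqr_t.
  have sqE z : z \in [:: a, b, c & t] -> z ^+ 2 = r%:C ^+ 2.
    by move=> /sqr_t; rewrite -eqf_sqr => /eqP.
  have [sa sb sc] : [/\ a ^+ 2 = r%:C ^+ 2, b ^+ 2 = r%:C ^+ 2 & c ^+ 2 = r%:C ^+ 2].
    by rewrite !sqE // !inE eqxx ?orbT.
  have [eq_bc|neq_bc] := eqVneq b c.
    by exists a, b, c, t; split=> //; rewrite -eq_bc -expr2 sa sb.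
  have [eq_ab|neq_ab] := eqVneq a b.
    exists c, a, b, t; rewrite -eq_ab -expr2 sa sc; split=> //.
    by rewrite -[[:: a, a, c & t]]/([:: a; a; c] ++ t) -[[:: c, a, a & t]]/([:: c; a; a] ++ t)
      perm_cat2r; apply/seq.permP => P /=; lia.
  exists b, a, c, t; split.
    by rewrite -[[:: a, b, c & t]]/([:: a; b; c] ++ t) -[[:: b, a, c & t]]/([:: b; a; c] ++ t)
      perm_cat2r; apply/seq.permP => P /=; lia.
  have := sqr_t a; have := sqr_t b; have := sqr_t c.
  rewrite !inE !eqxx ?orbT => /(_ isT) c_r /(_ isT) b_r /(_ isT) a_r.
  have -> : a = c.
    by move: neq_bc neq_ab; case/orP: c_r => /eqP ->; case/orP: b_r => /eqP ->;
      case/orP: a_r => /eqP -> //; rewrite eqxx.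
  by rewrite -expr2 sb sc.
have [x tx Imx] : exists2 x, x \in t & complex.Im x = 0.
  have [/hasP[x tx /eqP Imx]|no_real] := boolP (has (fun z => complex.Im z == 0) t).
    by exists x.
  (* Without real entries, conjugation matches the upper half plane with the lower one and the size
     would be even. *)
  pose up (z : R[i]) := 0 < complex.Im z; pose down (z : R[i]) := complex.Im z < 0.
  have eq_ud : count up t = count down t.
    rewrite -[LHS](seq.permP conj_t) count_map; apply: eq_count => -[a b] /=.
    by rewrite /up /down /= oppr_gt0.
  have : (count up t + count down t)%N = size t.
    rewrite -(count_predC up t); congr (_ + _)%N.
    apply: eq_in_count => z tz /=; have /hasPn/(_ z tz) := no_real.
    by rewrite /up /down; case: (ltrgtP 0 (complex.Im z)).
  by move=> sz; move: odd_t; rewrite -sz eq_ud addnn odd_double.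
have [z tz Imz] := hasP nreal.
have tJ : z^*%C \in t by rewrite -(perm_mem conj_t) map_f.
have zJ : z^*%C != z.
  by case: (z) Imz => a b /= b0; rewrite eq_complex /= eqxx /= eq_sym -addr_eq0 -mulr2n mulrn_eq0.
have zx : z != x by apply: contraNneq Imz => ->; rewrite Imx.
have zJx : z^*%C != x.
  by apply: contraNneq Imz => eqx; move: Imx; rewrite -eqx; case: (z) => a b /= /eqP; rewrite oppr_eq0.
have mem_rem (u v : R[i]) (l : seq R[i]) : u \in l -> u != v -> u \in rem v l.
  move=> lu uv; have [lv|/rem_id -> //] := boolP (v \in l).
  by move: lu; rewrite (perm_mem (perm_to_rem lv)) inE (negbTE uv).
exists x, z, z^*%C, (rem z^*%C (rem z (rem x t))); split.
  apply: perm_trans (perm_to_rem tx) _; rewrite perm_cons.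
  apply: perm_trans (perm_to_rem (mem_rem _ _ _ tz zx)) _; rewrite perm_cons.
  by apply: perm_to_rem; apply: (mem_rem _ _ _ _ zJ); apply: mem_rem.
by rewrite (real_sqr_modulus Imx) -modulus_sqr !mod_t.
Qed.

Lemma Dset_geometric_triple (n k H : nat) (f : {poly int}) :
  (3 <= k)%N -> odd k -> Dset R n k H f -> has_geometric_triple (croots (toC f)).
Proof.
move=> k_ge3 odd_k [mf szf hf nbf].
set r := max_modulus (toC f).
pose P (z : R[i]) := modulus z == r.
have sz_t : size (filter P (croots (toC f))) = k by rewrite size_filter.
have [||||x [y [w [t' [pt eq_sqr]]]]] := @conj_closed_triple (filter P (croots (toC f))) r.
- have := perm_filter P (croots_conj mf); rewrite filter_map.
  by congr perm_eq; congr map; apply: eq_filter => z; rewrite /P /= modulusJ.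
- by rewrite sz_t.
- by rewrite sz_t.
- by move=> z; rewrite mem_filter => /andP[/eqP].
apply: (@geometric_triple_perm _ (t' ++ filter (predC P) (croots (toC f))) x y w) => //.
apply: (@perm_trans _ (filter P (croots (toC f)) ++ filter (predC P) (croots (toC f)))).
  by rewrite perm_sym perm_filterC.
by rewrite -[[:: x, y, w & _]]/([:: x, y, w & t'] ++ _) perm_cat2r.
Qed.

End RealRoot.

(** * Cardinality bounds by parametrization and by covering *)

Section Counting.
Variable K : choiceType.
Implicit Types A B : set K.

Lemma card_fset_set_le (T : finType) (g : T -> K) A :
  finite_set A -> (forall a, A a -> exists t, a = g t) ->
  (#|` fset_set A| <= #|T|)%N.
Proof.
move=> finA sur; pose Y := [fset g t | t in T]%fset.
have sub : (fset_set A `<=` Y)%fset.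
  apply/fsubsetP => a; rewrite in_fset_set // inE => /sur[t ->].
  exact: in_imfset.
apply: leq_trans (fsubset_leq_card sub) _.
by apply: leq_trans (leq_imfset_card _ _ _) _; rewrite -cardE.
Qed.

Lemma card_fset_set_ge (T : finType) (g : T -> K) A :
  finite_set A -> injective g -> (forall t, A (g t)) ->
  (#|T| <= #|` fset_set A|)%N.
Proof.
move=> finA g_inj gA; pose Y := [fset g t | t in T]%fset.
have sub : (Y `<=` fset_set A)%fset.
  by apply/fsubsetP => a /imfsetP[t _ ->]; rewrite in_fset_set // inE; apply: gA.
apply: leq_trans (fsubset_leq_card sub).
by rewrite card_imfset //= -cardE.
Qed.

Lemma card_fset_set_box (n : nat) (N : 'I_n -> nat)
    (dec : {ffun 'I_n -> nat} -> K) A : finite_set A ->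
  (forall a, A a -> exists c : {ffun 'I_n -> nat},
     (forall i, (c i < N i)%N) /\ a = dec c) ->
  (#|` fset_set A| <= \prod_i N i)%N.
Proof.
move=> finA sur; pose T := {dffun forall i : 'I_n, 'I_(N i)}.
have -> : \prod_i N i = #|T|.
  rewrite card_dep_ffun foldrE big_map big_enum /=.
  by apply: eq_bigr => i _; rewrite card_ord.
apply: (card_fset_set_le (g := fun t : T => dec [ffun i => nat_of_ord (t i)])) => //.
move=> a /sur[c [lt_c ->]].
exists ([ffun i => Ordinal (lt_c i)] : T); congr dec.
by apply/ffunP => i; rewrite !ffunE.
Qed.

Lemma card_fset_set_cover (R : numDomainType) (M : nat) (B : nat -> set K) (b : R) A :
  finite_set A -> (forall a, A a -> exists2 m, (m < M)%N & B m a) ->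
  (forall m, (m < M)%N -> (#|` fset_set (A `&` B m)|)%:R <= b) ->
  (#|` fset_set A|)%:R <= M%:R * b.
Proof.
elim: M A => [|M ihM] A finA cover le_b.
  have -> : A = set0 by apply/seteqP; split=> // a /cover[].
  by rewrite fset_set0 cardfs0 mul0r.
pose A' := [set a | A a /\ exists2 m, (m < M)%N & B m a].
have finA' : finite_set A' by apply: sub_finite_set finA => a [].
have finB : finite_set (A `&` B M) by apply: sub_finite_set finA => a [].
have -> : A = A' `|` (A `&` B M).
  apply/seteqP; split=> a; last by case=> -[].
  move=> Aa; have [m] := cover a Aa; rewrite ltnS leq_eqVlt => /predU1P[->|lt_m] Ba.
    by right.
  by left; split=> //; exists m.
rewrite fset_setU //.
apply: (@le_trans _ _ ((#|` fset_set A'|)%:R + (#|` fset_set (A `&` B M)|)%:R)).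
  by rewrite -natrD ler_nat leq_card_fsetU.
rewrite -natr1 mulrDl mul1r lerD ?le_b //.
apply: ihM => // [a []//|m lt_m]; apply: le_trans (le_b m (ltnW lt_m)).
rewrite ler_nat fsubset_leq_card // -fset_set_sub.
- by move=> a [[Aa _] Ba].
- by apply: sub_finite_set finA' => a [].
- by apply: sub_finite_set finA => a [].
Qed.

End Counting.

(** * Counting monic integer polynomials with bounded coefficients *)

Section PolynomialBoxes.
Implicit Types (f : {poly int}) (A : set {poly int}).

Lemma count_bounded_coefs (n : nat) (B : 'I_n -> nat) A : finite_set A ->
  (forall f, A f -> [/\ f \is monic, size f = n.+1 & forall i : 'I_n, (`|(f`_i)%R| <= B i)%N]) ->
  (#|` fset_set A| <= \prod_i (2 * B i).+1)%N.
Proof.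
move=> finA hA; pose dec (c : {ffun 'I_n -> nat}) : {poly int} :=
  'X^n + \sum_(i < n) ((c i)%:Z - (B i)%:Z) *: 'X^i.
apply: (card_fset_set_box (dec := dec)) => // f /hA[mf szf le_B].
exists [ffun i : 'I_n => absz (f`_i + (B i)%:Z)]; split=> [i|].
  by rewrite ffunE; have := le_B i; lia.
rewrite -[LHS]coefK poly_def szf big_ord_recr /= addrC.
have -> : f`_n = 1 by move/monicP: mf; rewrite /lead_coef szf.
rewrite scale1r; congr (_ + _); apply: eq_bigr => i _; congr (_ *: _).
rewrite ffunE; have := le_B i; move: (f`_i) (B i) => a b; lia.
Qed.

(** The constant coefficient is encoded by its index in a list that the other coefficients
    determine, so it contributes a factor [D] instead of the length of an interval. *)
Lemma count_roots_over_box (n D : nat) (B : 'I_n -> nat)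
    (s : {poly int} -> seq int) A : finite_set A -> (forall f, (size (s f) <= D)%N) ->
  (forall f, A f -> [/\ f \is monic, size f = n.+2,
     forall i : 'I_n, (`|(f`_i.+1)%R| <= B i)%N & f`_0 \in s (f - (f`_0)%:P)]) ->
  (#|` fset_set A| <= D * \prod_i (2 * B i).+1)%N.
Proof.
move=> finA sD hA; pose F (c : {ffun 'I_n.+1 -> nat}) : {poly int} :=
  'X^(n.+1) + \sum_(i < n) ((c (lift ord0 i))%:Z - (B i)%:Z) *: 'X^(i.+1).
pose dec c := F c + (nth 0 (s (F c)) (c ord0))%:P.
pose N (i : 'I_n.+1) := if unlift ord0 i is Some j then (2 * B j).+1 else D.
have -> : (D * \prod_i (2 * B i).+1 = \prod_i N i)%N.
  rewrite big_ord_recl {1}/N unlift_none; congr (_ * _)%N.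
  by apply: eq_bigr => i _; rewrite /N liftK.
apply: (card_fset_set_box (dec := dec)) => // f /hA[mf szf le_B s0].
pose c : {ffun 'I_n.+1 -> nat} := [ffun i =>
  if unlift ord0 i is Some j then absz (f`_j.+1 + (B j)%:Z)
  else index f`_0 (s (f - (f`_0)%:P))].
have Fc : F c = f - (f`_0)%:P.
  rewrite -[f in f - _]coefK poly_def szf big_ord_recr big_ord_recl /= expr0 alg_polyC.
  have -> : f`_n.+1 = 1 by move/monicP: mf; rewrite /lead_coef szf.
  rewrite scale1r /F [X in _ = X - _]addrC [X in _ = _ + X - _]addrC addrA addrK; congr (_ + _).
  apply: eq_bigr => i _; rewrite /bump /= add1n; congr (_ *: _).
  by rewrite ffunE liftK; have := le_B i; move: (f`_i.+1) (B i) => a b; lia.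
exists c; split=> [i|].
  rewrite /N ffunE; case: unliftP => [j _|_]; first by have := le_B j; move: (f`_j.+1) (B j) => a b; lia.
  by apply: leq_trans (sD (f - (f`_0)%:P)); rewrite index_mem.
by rewrite /dec Fc ffunE unlift_none nth_index // subrK.
Qed.

End PolynomialBoxes.

(** * The upper bounds *)

Section UpperBound.
Variables (R : realType) (n k : nat).
Hypotheses (k_ge3 : (3 <= k)%N) (k_le_n : (k <= n)%N).
Local Notation toC := (int_to_cpoly R).

Let n_gt0 : (0 < n)%N.
Proof. by apply: leq_trans k_le_n; apply: leq_trans k_ge3. Qed.

(** In the scale [h = H^(1/k)] the coefficient of [X^i] is bounded, up to a constant, by
    [r^(n - i) = O(h^(n - i))] and also by [H = h^k]. *)
Let E i := minn (n - i) k.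
Let K0 : R := 2 ^+ n * n%:R ^+ n.

Let K0_ge1 : 1 <= K0.
Proof. by rewrite mulr_ege1 // exprn_ege1 // ler1n. Qed.

Lemma prod_le_powers (I : finType) (N e : I -> nat) (c h : R) :
  (forall i, (N i)%:R <= c * h ^+ e i) ->
  (\prod_i N i)%:R <= c ^+ #|I| * h ^+ (\sum_i e i)%N.
Proof.
move=> le_N; rewrite natr_prod.
apply: (@le_trans _ _ (\prod_(i : I) (c * h ^+ e i))).
  by apply: ler_prod => i _; rewrite ler0n le_N.
by rewrite big_split /= prodr_const prodrXr.
Qed.

(** The sum is [1 + ... + k] followed by [n - k] terms equal to [k]. *)
Lemma sum_minn : (2 * \sum_(i < n) minn (n - i) k = k * (k + 1) + 2 * (k * (n - k)))%N.
Proof.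
rewrite -[in LHS](subnKC k_le_n); move: (n - k)%N => d; elim: d => [|d ihd].
  rewrite addn0 muln0 addn0.
  transitivity (2 * \sum_(i < k) (k - i))%N.
    by congr (2 * _)%N; apply: eq_bigr => i _; rewrite (minn_idPl _) // leq_subr.
  elim: (k) => [|m ihm]; first by rewrite big_ord0.
  by rewrite big_ord_recl /= subn0 mulnDr ihm; lia.
rewrite addnS big_ord_recl /= subn0 mulnDr [(2 * _ + _)%N]addnC.
rewrite (minn_idPr _); last by lia.
by rewrite ihd; lia.
Qed.

(** * Counting at a fixed height *)

Section FixedHeight.
Variable H : nat.
Hypothesis H_gt0 : (0 < H)%N.
Let h : R := H%:R `^ k%:R^-1.

Let k_gt0 : (0 < k)%N. Proof. by apply: leq_trans k_ge3. Qed.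

Let hk : h ^+ k = H%:R.
Proof.
rewrite -powR_mulrn ?powR_ge0 // -powRrM mulVf ?powRr1 //.
by rewrite pnatr_eq0 -lt0n.
Qed.

Let h_ge1 : 1 <= h.
Proof.
have h_ge0 : 0 <= h by apply: powR_ge0.
by rewrite -(ler_pXn2r k_gt0) ?nnegrE // expr1n hk ler1n.
Qed.

Let B i := Num.trunc (K0 * h ^+ E i).

Let bnd_ge0 i : 0 <= K0 * h ^+ E i.
Proof. by rewrite mulr_ge0 ?exprn_ge0 ?(le_trans ler01). Qed.

Let le_B i : ((2 * B i).+1)%:R <= 3 * K0 * h ^+ E i.
Proof.
have K1 := K0_ge1; have h1 : 1 <= h ^+ E i by rewrite exprn_ege1.
have : (B i)%:R <= K0 * h ^+ E i by rewrite truncn_le bnd_ge0.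
have : 1 <= K0 * h ^+ E i by rewrite mulr_ege1.
by rewrite -natr1 natrM; lra.
Qed.

Lemma Dset_coef_bound f (i : 'I_n) : Dset R n k H f -> (`|(f`_i)%R| <= B i)%N.
Proof.
move=> Df; have [mf szf hf _] := Df.
have h_ge0 : 0 <= h by apply: powR_ge0.
have r_ge0 := max_modulus_ge0 (toC f).
have n_ge1 : 1 <= n%:R :> R by rewrite ler1n.
have le_r : max_modulus (toC f) <= n%:R * h.
  rewrite -(ler_pXn2r k_gt0) ?nnegrE ?mulr_ge0 //.
  by rewrite exprMn hk; apply: max_modulus_bound Df.
rewrite truncn_ge_nat ?bnd_ge0 //.
have [le_k|lt_k] := leqP (n - i) k.
  have lt_i : (i < size f)%N by rewrite szf ltnW // ltnS.
  have := coef_bound R mf lt_i; rewrite coef_toC modulus_int szf /= => le1.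
  rewrite /E (minn_idPl le_k); apply: le_trans le1 _.
  rewrite /K0 -mulrA ler_wpM2l ?exprn_ge0 //.
  apply: (@le_trans _ _ ((n%:R * h) ^+ (n - i))).
    by rewrite lerXn2r ?nnegrE ?mulr_ge0.
  by rewrite exprMn ler_wpM2r ?exprn_ge0 // ler_weXn2l // leq_subr.
rewrite /E (minn_idPr (ltnW lt_k)) hk; apply: (@le_trans _ _ H%:R).
  by rewrite ler_nat; apply: leq_trans (coef_le_height _ _) hf.
by rewrite ler_peMl.
Qed.

Lemma Dcount_le_trivial :
  (Dcount R n k H)%:R <= (3 * K0) ^+ n * h ^+ (\sum_(i < n) E i)%N.
Proof.
apply: (@le_trans _ _ (\prod_(i < n) (2 * B i).+1)%N%:R).
  rewrite ler_nat; apply: count_bounded_coefs; first exact: Dset_finite.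
  by move=> f Df; have [mf szf _ _] := Df; split=> // i; apply: Dset_coef_bound.
by rewrite -[X in _ ^+ X * _](card_ord n); apply: prod_le_powers => i; apply: le_B.
Qed.

(** The constant coefficient is left free, so this is a property of the whole family [f + t]. *)
Definition degenerate (f : {poly int}) (m : nat) : Prop :=
  [/\ (3 <= m)%N, (m %| n)%N &
      forall j, (0 < j < n)%N -> f`_j != 0 -> (m %| j)%N].

(** If [m] does not divide [k], the index [n - k] is dropped and carries weight [k]. Otherwise
    [n - k + 1] and [n - k + 2] are dropped, with weights [k - 1] and [k - 2], whose sum is at least
    [k] because [k >= 3]. *)
Lemma degenerate_exponent (m : nat) : (3 <= m)%N -> (m %| n)%N ->
  (\sum_(i < n | (nat_of_ord i == 0) || (m %| i)) E i + k <= \sum_(i < n) E i)%N.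
Proof.
move=> m_ge3 m_dvd_n.
rewrite [leqRHS](bigID (fun i : 'I_n => (nat_of_ord i == 0) || (m %| i)))%N leq_add2l.
have [m_dvd_k|m_ndvd_k] := boolP (m %| k)%N; last first.
  have lt_kn : (k < n)%N.
    by rewrite ltn_neqAle k_le_n andbT; apply: contraNneq m_ndvd_k => ->.
  have lt_i : (n - k < n)%N by rewrite ltn_subrL k_gt0.
  rewrite (bigD1 (Ordinal lt_i)) /=; last first.
    rewrite negb_or subn_eq0 -ltnNge lt_kn /=.
    by apply: contra m_ndvd_k => m_dvd; rewrite -(dvdn_addr _ m_dvd) subnK.
  by rewrite /E subKn // minnn leq_addr.
have m_dvd_nk : (m %| n - k)%N by rewrite dvdn_sub.
have lt1 : (n - k + 1 < n)%N by lia.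
have lt2 : (n - k + 2 < n)%N by lia.
have ndvd j : (0 < j < 3)%N -> ~~ (m %| n - k + j)%N.
  move=> /andP[j_gt0 j_lt3]; rewrite dvdn_addr // gtnNdvd //.
  exact: leq_trans j_lt3 m_ge3.
rewrite (bigD1 (Ordinal lt1)) /=; last by rewrite addn1 /= -addn1 ndvd.
rewrite (bigD1 (Ordinal lt2)) /=; last first.
  by rewrite -val_eqE /= addn2 /= -addn2 ndvd // eqn_add2l.
by rewrite /E; lia.
Qed.

(** The coefficients forced to vanish leave the box, which saves at least [h^k = H]. *)
Lemma count_degenerate (m : nat) :
  (#|` fset_set (Dset R n k H `&` [set f | degenerate f m])|)%:R <=
    (3 * K0) ^+ n * h ^+ (\sum_(i < n) E i - k)%N.
Proof.
set A := _ `&` _.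
have finA : finite_set A.
  by apply: sub_finite_set (Dset_finite R n k H) => f [].
have [->|/set0P[f0 [_ [m_ge3 m_dvd_n _]]]] := eqVneq A set0.
  rewrite fset_set0 cardfs0 mulr_ge0 ?exprn_ge0 ?powR_ge0 //.
  by rewrite mulr_ge0 // (le_trans ler01).
pose P (i : 'I_n) := (nat_of_ord i == 0%N) || (m %| i)%N.
pose B' (i : 'I_n) := if P i then B i else 0%N.
pose e (i : 'I_n) := if P i then E i else 0%N.
apply: (@le_trans _ _ (\prod_(i < n) (2 * B' i).+1)%N%:R).
  rewrite ler_nat; apply: count_bounded_coefs => // f [Df [_ _ deg_f]].
  have [mf szf _ _] := Df; split=> // i; rewrite /B'; case: ifP => [_|/negbT].
    exact: Dset_coef_bound.
  rewrite negb_or -lt0n => /andP[i_gt0]; apply: contraNT; rewrite -ltnNge absz_gt0.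
  by apply: deg_f; rewrite i_gt0 ltn_ord.
apply: (@le_trans _ _ ((3 * K0) ^+ n * h ^+ (\sum_(i < n) e i)%N)).
  rewrite -[X in _ ^+ X * _](card_ord n); apply: prod_le_powers => i.
  rewrite /B' /e; case: ifP => _; first exact: le_B.
  by rewrite muln0 expr0 mulr1; have := K0_ge1; lra.
have K_ge0 : 0 <= (3 * K0) ^+ n.
  by apply: exprn_ge0; apply: mulr_ge0 => //; apply: le_trans ler01 K0_ge1.
apply: ler_wpM2l => //; apply: ler_weXn2l => //; rewrite /e -big_mkcond /=.
have : forall a b c : nat, (a + b <= c -> a <= c - b)%N by clear; lia.
by apply; apply: degenerate_exponent.
Qed.

Lemma toC_addC (f : {poly int}) (a : int) : toC (f + a%:P) = toC f + (a%:~R)%:P.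
Proof. by rewrite /int_to_cpoly rmorphD /= map_polyC. Qed.

(** For given higher coefficients, [q] is nonzero by [geometric_triples_degenerate], so fewer than
    [D] constant coefficients remain, or none. Fixing [D] in advance makes it independent of [H]. *)
Lemma count_nondegenerate (D : nat) :
  (forall F : {poly R[i]}, (0 < n)%N -> F \is monic -> size F = n.+1 ->
    exists2 q : {poly R[i]}, (size q <= D)%N &
      forall t, q.[t] = 0 <-> has_geometric_triple (croots (F + t%:P))) ->
  odd k ->
  (#|` fset_set (Dset R n k H `&` [set f | ~ exists m, degenerate f m])|)%:R <=
    D%:R * ((3 * K0) ^+ n * h ^+ (\sum_(i < n) E i - k)%N).
Proof.
move=> hD odd_k; set A := _ `&` _.
have finA : finite_set A.
  by apply: sub_finite_set (Dset_finite R n k H) => f [].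
(* [s] lists the candidates for the constant coefficient over [F]; it is empty if [F] has the wrong
   shape or is degenerate. *)
have ex_s (F : {poly int}) : exists s : seq int, (size s <= D)%N /\
    (F \is monic -> size F = n.+1 -> (~ exists m, degenerate F m) ->
     forall a : int, has_geometric_triple (croots (toC F + (a%:~R)%:P)) -> a \in s).
  have [[mF [szF nondeg]]|nF] := pselect (F \is monic /\ size F = n.+1 /\ ~ exists m, degenerate F m);
    last by exists [::]; split=> // mF szF nondeg; case: nF.
  have mp : toC F \is monic by rewrite monic_toC.
  have szp : size (toC F) = n.+1 by rewrite size_toC.
  have [q szq qP] := hD (toC F) n_gt0 mp szp.
  have q_neq0 : q != 0.
    apply/eqP => q0; apply: nondeg.
    have [t|m m_ge3 m_dvd] := @geometric_triples_degenerate R n (toC F) n_gt0 mp szp.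
      by apply/qP; rewrite q0 horner0.
    exists m; split=> // [|j /andP[j_gt0 lt_jn] Fj].
      apply: m_dvd; first by rewrite n_gt0 leqnn.
      by move: mp; rewrite monicE /lead_coef szp => /eqP ->; apply: oner_neq0.
    apply: m_dvd; first by rewrite j_gt0 ltnW.
    by rewrite coef_toC intr_eq0.
  (* An integer root of [q] is the floor of its own real part; the floors of other roots only
     enlarge the list. *)
  exists [seq Num.floor (complex.Re z) | z <- croots q]; split.
    rewrite size_map; apply: leq_trans szq.
    rewrite {2}[q]croots_spec size_scale ?lead_coef_eq0 // size_prod_XsubC.
    exact: leqnSn.
  move=> _ _ _ a /qP qa; apply/mapP; exists (a%:~R).
    have := q_neq0; rewrite -lead_coef_eq0 => lq.
    by rewrite -root_prod_XsubC -(rootZ _ _ lq) -croots_spec; apply/rootP.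
  by rewrite -(rmorph_int (real_complex R)) /= intrKfloor.
have [s sP] := choice ex_s.
have nE : n.-1.+1 = n by rewrite prednK.
(* The constant coefficient has weight [E 0 = k], which is the saving. *)
have sumE : (\sum_(i < n.-1) E i.+1 = \sum_(i < n) E i - k)%N.
  have -> : (\sum_(i < n) E i = \sum_(i < n.-1.+1) E i)%N by rewrite nE.
  by rewrite big_ord_recl /= {2}/E subn0 (minn_idPr k_le_n) addKn.
apply: (@le_trans _ _ (D * \prod_(i < n.-1) (2 * B i.+1).+1)%N%:R).
  rewrite ler_nat; apply: (@count_roots_over_box n.-1 D (fun i => B i.+1) s) => //.
    by move=> F; have [] := sP F.
  move=> f [Df nondeg]; have [mf szf _ _] := Df; split=> //; first by rewrite nE.
    move=> i; have lt_i : (i.+1 < n)%N by rewrite -{2}nE ltnS.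
    exact: (@Dset_coef_bound f (Ordinal lt_i)).
  have szF : size (f - (f`_0)%:P) = n.+1.
    by rewrite size_polyDl ?size_polyN // size_polyC szf; case: (_ != 0).
  have coefF j : (0 < j)%N -> (f - (f`_0)%:P)`_j = f`_j.
    by move=> j_gt0; rewrite coefB coefC eqn0Ngt j_gt0 subr0.
  have [_] := sP (f - (f`_0)%:P); apply=> //.
  - by rewrite monicE /lead_coef szF coefF //; move: mf; rewrite monicE /lead_coef szf.
  - case=> m [m_ge3 m_dvd deg]; apply: nondeg; exists m; split=> // j.
    by move=> /[dup] /andP[j_gt0 _] /deg; rewrite coefF.
  - by rewrite -toC_addC subrK; apply: Dset_geometric_triple Df.
rewrite natrM ler_wpM2l // -sumE.
apply: (@le_trans _ _ ((3 * K0) ^+ n.-1 * h ^+ (\sum_(i < n.-1) E i.+1)%N)).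
  by rewrite -[X in _ ^+ X * _](card_ord n.-1); apply: prod_le_powers => i; apply: le_B.
rewrite ler_wpM2r ?exprn_ge0 ?powR_ge0 // ler_weXn2l ?leq_pred //.
by have := K0_ge1; lra.
Qed.

Lemma Dcount_le_odd (D : nat) :
  (forall F : {poly R[i]}, (0 < n)%N -> F \is monic -> size F = n.+1 ->
    exists2 q : {poly R[i]}, (size q <= D)%N &
      forall t, q.[t] = 0 <-> has_geometric_triple (croots (F + t%:P))) ->
  odd k ->
  (Dcount R n k H)%:R <=
    n.+1%:R * (D.+1%:R * ((3 * K0) ^+ n * h ^+ (\sum_(i < n) E i - k)%N)).
Proof.
(* Index 0 is the nondegenerate part. In the others [m] divides [n], so indices up to [n] suffice;
   [D.+1] dominates both [D] and 1. *)
move=> hD odd_k; pose part m : set {poly int} :=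
  if m is 0 then [set f | ~ exists m, degenerate f m] else [set f | degenerate f m].
have b_ge0 : 0 <= (3 * K0) ^+ n * h ^+ (\sum_(i < n) E i - k)%N.
  by apply: le_trans (count_degenerate 0); apply: ler0n.
apply: (@card_fset_set_cover _ _ n.+1 part); first exact: Dset_finite.
  move=> f _; have [[m deg]|nondeg] := pselect (exists m, degenerate f m); last by exists 0%N.
  have [m_ge3 m_dvd_n _] := deg; exists m; first by rewrite ltnS dvdn_leq.
  by rewrite /part; case: m m_ge3 {m_dvd_n} deg.
move=> [|m] _; rewrite /part.
  apply: le_trans (count_nondegenerate hD odd_k) _.
  by rewrite ler_wpM2r // ler_nat.
apply: le_trans (count_degenerate m.+1) _.
by rewrite ler_peMl // ler1n.
Qed.

Lemma root_power_eq (m : nat) : h ^+ m = H%:R `^ (m%:R / k%:R).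
Proof. by rewrite -powR_mulrn ?powR_ge0 // -powRrM mulrC. Qed.

End FixedHeight.

Let sumE_real : 2 * (\sum_(i < n) E i)%N%:R = k%:R * (k%:R + 1) + 2 * (k%:R * (n%:R - k%:R)) :> R.
Proof.
rewrite -[2 in LHS]/(2%N%:R) -natrM sum_minn natrD !natrM natrD natrB //.
Qed.

Lemma Dcount_upper_even : exists2 c : R, 0 < c & forall H, (1 <= H)%N ->
  (Dcount R n k H)%:R <= c * H%:R `^ (n%:R - (k%:R - 1) / 2).
Proof.
have K1 := K0_ge1.
exists ((3 * K0) ^+ n); first by rewrite exprn_gt0 //; lra.
move=> H H_gt0; apply: le_trans (Dcount_le_trivial H_gt0) _.
rewrite root_power_eq le_eqVlt; apply/orP; left; apply/eqP; congr (_ * _ `^ _).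
have k_neq0 : k%:R != 0 :> R by rewrite pnatr_eq0 -lt0n (leq_trans _ k_ge3).
apply: (mulfI k_neq0); rewrite mulrCA mulfV // mulr1.
by have := sumE_real; rewrite mulrBr; lra.
Qed.

Lemma Dcount_upper_odd : odd k -> exists2 c : R, 0 < c & forall H, (1 <= H)%N ->
  (Dcount R n k H)%:R <= c * H%:R `^ (n%:R - (k%:R + 1) / 2).
Proof.
move=> odd_k; have K1 := K0_ge1; have [D hD] := triple_poly R n.
exists (n.+1%:R * (D.+1%:R * (3 * K0) ^+ n)).
  by rewrite !mulr_gt0 ?ltr0n // exprn_gt0 //; lra.
move=> H H_gt0; apply: le_trans (Dcount_le_odd H_gt0 hD odd_k) _.
rewrite !mulrA root_power_eq le_eqVlt; apply/orP; left; apply/eqP; congr (_ * _ `^ _).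
have k_neq0 : k%:R != 0 :> R by rewrite pnatr_eq0 -lt0n (leq_trans _ k_ge3).
apply: (mulfI k_neq0); rewrite mulrCA mulfV // mulr1 natrB.
  by have := sumE_real; lra.
have le_k : (k * 2 <= k * (k + 1))%N by rewrite leq_mul2l addn1 ltnS (leq_trans _ k_ge3) ?orbT.
rewrite -(leq_pmul2l (isT : 0 < 2)%N) [leqRHS]sum_minn mulnC.
exact: leq_trans le_k (leq_addr _ _).
Qed.

End UpperBound.

(** * Monic integer polynomials with prescribed lower coefficients *)

Section MonicPolynomials.
Variable n : nat.
Implicit Types a : 'I_n -> int.

Definition monic_of a : {poly int} := 'X^n + \poly_(i < n) oapp a 0 (insub i).

Lemma coef_monic_of a (i : 'I_n) : (monic_of a)`_i = a i.
Proof.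
by rewrite coefD coefXn coef_poly ltn_ord ltn_eqF //= valK /= add0r.
Qed.

Lemma size_monic_of a : size (monic_of a) = n.+1.
Proof. by rewrite size_polyDl ?size_polyXn // ltnS size_poly. Qed.

Lemma monic_of_monic a : monic_of a \is monic.
Proof.
rewrite monicE /lead_coef size_monic_of /=.
by rewrite coefD coefXn eqxx coef_poly ltnn addr0.
Qed.

Lemma horner_monic_of (K : comNzRingType) a (x : K) :
  (map_poly intr (monic_of a)).[x] = x ^+ n + \sum_(i < n) (a i)%:~R * x ^+ i.
Proof.
rewrite rmorphD /= hornerD map_polyXn hornerXn; congr (_ + _).
rewrite (@horner_coef_wide _ n).
  by apply: eq_bigr => i _; rewrite coef_map coef_poly ltn_ord valK.
by apply: leq_trans (size_poly _ _) (size_poly _ _).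
Qed.

End MonicPolynomials.

(** * An open set of real-rooted polynomials *)

Section RealRooted.
Variables (R : realType) (l : nat).

(** The model roots [tau i] are equally spaced in [(-1, 1)], and [node i] and [node i.+1] lie on
    either side of [tau i] at distance [1 / (l + 1)]. *)
Let tau (i : nat) : R := (2 * i%:R + 1 - l%:R) / l.+1%:R.
Let node (j : nat) : R := (2 * j%:R - l%:R) / l.+1%:R.
Definition model_poly : {poly R} := \prod_(i < l) ('X - (tau i)%:P).
Local Notation T0 := model_poly.

Let nodeBtau i j : node j - tau i = (2 * (j%:R - i%:R) - 1) / l.+1%:R.
Proof. by rewrite /node /tau -mulrBl; congr (_ / _); ring. Qed.

Let horner_T0 x : T0.[x] = \prod_(i < l) (x - tau i).
Proof. by rewrite horner_prod; apply: eq_bigr => i _; rewrite hornerXsubC. Qed.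

Let odd_ge1 (i j : nat) : 1 <= `|2 * (j%:R - i%:R) - 1| :> R.
Proof.
have -> : 2 * (j%:R - i%:R) - 1 = (2 * (j%:Z - i%:Z) - 1)%:~R :> R.
  by rewrite rmorphB rmorphM rmorphB.
by rewrite -intr_norm -[1]/(1%:~R) ler_int; lia.
Qed.

(** Every factor is an odd integer over [l + 1], hence at least [1 / (l + 1)] in absolute value. *)
Let T0_node_ge j : l.+1%:R ^- l <= `|T0.[node j]|.
Proof.
rewrite horner_T0 normr_prod -exprVn -[X in _ ^+ X](card_ord l) -prodr_const.
apply: ler_prod => i _; rewrite invr_ge0 ler0n /= nodeBtau normrM.
by rewrite [X in _ * X]gtr0_norm ?invr_gt0 ?ltr0n // ler_peMl ?invr_ge0 ?odd_ge1.
Qed.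

(* The factor of index [i] of this product is [(4 (j - i)^2 - 1) / (l + 1)^2]:
   only the one with [i = j] is negative. *)
Let T0_alternates j : (j < l)%N -> T0.[node j] * T0.[node j.+1] < 0.
Proof.
move=> lt_jl; rewrite !horner_T0 -big_split /=.
have facE i : (node j - tau i) * (node j.+1 - tau i) =
    (4 * (j%:R - i%:R) ^+ 2 - 1) / l.+1%:R ^+ 2.
  by rewrite !nodeBtau -[j.+1%:R]natr1; field; rewrite addrC natr1 pnatr_eq0.
under eq_bigr do rewrite facE.
have l2 : 0 < (l.+1%:R ^+ 2)^-1 :> R by rewrite invr_gt0 exprn_gt0 ?ltr0n.
rewrite (bigD1 (Ordinal lt_jl)) //= pmulr_llt0.
  by rewrite subrr expr0n /= mulr0 sub0r mulN1r oppr_lt0.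
apply: prodr_gt0 => i neq_ij; rewrite mulr_gt0 //.
have -> : 4 * (j%:R - i%:R) ^+ 2 - 1 = (4 * (j%:Z - i%:Z) ^+ 2 - 1)%:~R :> R.
  by rewrite rmorphB rmorphM rmorphXn rmorphB.
rewrite ltr0z; move: neq_ij; rewrite -val_eqE /= => neq_ij.
have : j%:Z - i%:Z != 0 by lia.
by move: (j%:Z - i%:Z) => d d_neq0; rewrite expr2; nia.
Qed.

Let node_lt1 j : (j <= l)%N -> `|node j| < 1.
Proof.
move=> le_jl; rewrite normrM [X in _ * X]gtr0_norm ?invr_gt0 ?ltr0n //.
rewrite ltr_pdivrMr ?ltr0n // mul1r -[l.+1%:R]natr1.
have : j%:R <= l%:R :> R by rewrite ler_nat.
by rewrite ltr_norml => ?; apply/andP; split; have := ler0n R j; lra.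
Qed.

Let node_lt j : node j < node j.+1.
Proof.
by rewrite /node ltr_pM2r ?invr_gt0 ?ltr0n // -[j.+1%:R]natr1; lra.
Qed.

Let node_mono i j : (i <= j)%N -> node i <= node j.
Proof.
move=> le_ij; rewrite /node ler_pM2r ?invr_gt0 ?ltr0n //.
have : i%:R <= j%:R :> R by rewrite ler_nat.
by lra.
Qed.

Let same_sign (x y : R) : `|x - y| < `|y| -> 0 < x * y.
Proof.
case: (ltrgtP 0 y) => [y_gt0|y_lt0|<-].
- by rewrite (gtr0_norm y_gt0) ltr_norml => /andP[lt1 _]; rewrite mulr_gt0 //; lra.
- by rewrite (ltr0_norm y_lt0) ltr_norml => /andP[_ lt1]; rewrite nmulr_lgt0 //; lra.
- by rewrite normr0 normr_lt0.
Qed.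

(** The perturbation of [r^l T0(X / r)] is smaller than its values at the [l + 1] points
    [r * node j]. The sign changes survive there, and the [l] gaps provide all the roots. *)
Lemma perturbation_real_rooted (r : nat) (a : 'I_l -> int) : (0 < r)%N ->
  (forall i, `|(a i)%:~R - r%:R ^+ (l - i) * T0`_i| <=
             r%:R ^+ (l - i) / l.+1%:R ^+ l.+1) ->
  exists xs : seq R, [/\ size xs = l,
    map_poly intr (monic_of a) = \prod_(x <- xs) ('X - x%:P) &
    forall x, x \in xs -> `|x| < r%:R].
Proof.
move=> r_gt0 close; set T : {poly R} := map_poly intr _.
have r_gt0' : 0 < r%:R :> R by rewrite ltr0n.
have l_gt0 : 0 < l.+1%:R :> R by rewrite ltr0n.
have mT0 : T0 \is monic by apply: monic_prod_XsubC.
have szT0 : size T0 = l.+1.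
  by rewrite size_prod_XsubC -[RHS]/(l.+1) /index_enum -enumT size_enum_ord.
have closeT j : (j <= l)%N ->
    `|T.[r%:R * node j] - r%:R ^+ l * T0.[node j]| < `|r%:R ^+ l * T0.[node j]|.
  move=> le_jl; rewrite horner_monic_of {1}(horner_coef T0) szT0 big_ord_recr /=.
  have -> : T0`_l = 1 by move: mT0; rewrite monicE /lead_coef szT0 => /eqP.
  rewrite mul1r mulrDr [X in _ - X]addrC -exprMn opprD addrACA subrr add0r.
  rewrite mulr_sumr -sumrB.
  have rl_gt0 : 0 < r%:R ^+ l :> R by rewrite exprn_gt0.
  rewrite normrM (gtr0_norm rl_gt0); apply: le_lt_trans (ler_norm_sum _ _ _) _.
  (* The [l] error terms sum to less than [r^l / (l + 1)^l], the lower bound for the rescaled model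
     at the nodes. *)
  apply: (@le_lt_trans _ _ (\sum_(i < l) r%:R ^+ l / l.+1%:R ^+ l.+1)).
    apply: ler_sum => i _.
    have rE : r%:R ^+ l = r%:R ^+ (l - i) * r%:R ^+ i :> R.
      by rewrite -exprD subnK // ltnW.
    have -> : (a i)%:~R * (r%:R * node j) ^+ i - r%:R ^+ l * (T0`_i * node j ^+ i) =
        ((a i)%:~R - r%:R ^+ (l - i) * T0`_i) * (r%:R * node j) ^+ i.
      by rewrite exprMn rE; ring.
    rewrite normrM rE mulrAC; apply: ler_pM => //.
    rewrite normrX normrM (gtr0_norm r_gt0') exprMn.
    by rewrite ler_piMr ?exprn_ge0 ?(ltW r_gt0') // exprn_ile1 // ltW // node_lt1.
  rewrite sumr_const card_ord -[_ *+ l]mulr_natr -mulrA ltr_pM2l //.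
  apply: lt_le_trans (T0_node_ge j).
  rewrite exprS invfM mulrAC -[ltRHS]mul1r ltr_pM2r ?invr_gt0 ?exprn_gt0 //.
  by rewrite mulrC ltr_pdivrMr // mul1r ltr_nat.
have root_T j : (j < l)%N ->
    {x | r%:R * node j < x < r%:R * node j.+1 & root T x}.
  move=> lt_jl; have le_jl := ltnW lt_jl.
  have [||x] := @poly_ivtoo R T (r%:R * node j) (r%:R * node j.+1).
  - by rewrite ler_pM2l // ltW.
  - have := same_sign (closeT _ le_jl); have := same_sign (closeT _ lt_jl).
    set x := T.[_]; set y := T.[_] => hx hy.
    have rl2 : 0 < r%:R ^+ l * r%:R ^+ l :> R by rewrite mulr_gt0 ?exprn_gt0.
    have neg : r%:R ^+ l * T0.[node j] * (r%:R ^+ l * T0.[node j.+1]) < 0.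
      by rewrite mulrACA pmulr_rlt0 // T0_alternates.
    have : 0 < (y * x) * (r%:R ^+ l * T0.[node j] * (r%:R ^+ l * T0.[node j.+1])).
      by rewrite mulrACA mulr_gt0.
    by rewrite nmulr_lgt0.
  - by rewrite in_itv => itv_x root_x; exists x.
(* The root in gap [j] is extracted only for [j < l]; the default 0 is never listed. *)
pose x_ (j : nat) : R := if (j < l)%N =P true is ReflectT lt_jl then s2val (root_T j lt_jl) else 0.
have x_P j : (j < l)%N -> r%:R * node j < x_ j < r%:R * node j.+1 /\ root T (x_ j).
  by move=> lt_jl; rewrite /x_; case: eqP => // h; case: (root_T j h).
have x_lt i j : (i < j < l)%N -> x_ i < x_ j.
  move=> /andP[lt_ij lt_jl]; have [/andP[_ lt1] _] := x_P _ (ltn_trans lt_ij lt_jl).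
  have [/andP[lt2 _] _] := x_P _ lt_jl; apply: lt_trans lt1 _; apply: le_lt_trans lt2.
  by rewrite ler_pM2l // node_mono.
have szT : size T = l.+1 by rewrite size_map_inj_poly ?size_monic_of //; apply: intr_inj.
exists (mkseq x_ l); rewrite size_mkseq; split=> //.
  rewrite [LHS](@all_roots_prod_XsubC _ T (mkseq x_ l)).
  - rewrite /lead_coef szT coef_map /= coefD coefXn eqxx coef_poly ltnn addr0.
    by rewrite scale1r.
  - by rewrite szT size_mkseq.
  - by apply/allP => y /mapP[j]; rewrite mem_iota => /x_P[_ root_y] ->.
  - rewrite uniq_rootsE map_inj_in_uniq ?iota_uniq // => i j.
    rewrite !mem_iota /= add0n => lt_il lt_jl eq_x; case: (ltngtP i j) => // lt_ij.
      by have := x_lt i j; rewrite lt_ij lt_jl eq_x ltxx => /(_ isT).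
    by have := x_lt j i; rewrite lt_ij lt_il eq_x ltxx => /(_ isT).
move=> y /mapP[j]; rewrite mem_iota add0n /= => lt_jl ->.
have [/andP[lt1 lt2] _] := x_P _ lt_jl.
have := node_lt1 (ltnW lt_jl); have := node_lt1 lt_jl.
rewrite !ltr_norml => /andP[n1 n2] /andP[n3 n4]; apply/andP; split.
  by apply: lt_trans lt1; rewrite -mulrN1 ltr_pM2l.
by apply: lt_trans lt2 _; rewrite -[ltRHS]mulr1 ltr_pM2l.
Qed.

End RealRooted.

(** * From real roots to roots on a circle, and polynomials with small roots *)

Section Joukowski.
Variable R : realType.
Local Notation toC := (int_to_cpoly R).

Lemma poly_eq_off0 (p q : {poly R[i]}) :
  (forall z, z != 0 -> p.[z] = q.[z]) -> p = q.
Proof.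
move=> eq_pq; apply/eqP; rewrite -subr_eq0; apply/negPn/negP => nz.
pose pts : seq R[i] := mkseq (fun i => i.+1%:R) (size (p - q)).
have : (size pts < size (p - q)%R)%N.
  apply: max_poly_roots nz _ _.
    apply/allP => z /mapP[i _ ->]; rewrite rootE hornerD hornerN eq_pq ?subrr //.
    by rewrite pnatr_eq0.
  by rewrite map_inj_uniq ?iota_uniq // => i j /eqP; rewrite eqr_nat eqSS => /eqP.
by rewrite size_mkseq ltnn.
Qed.

(* For [T] of degree [l], this is [X^l * T(X + rho / X)]. *)
Definition joukowski (rho : int) (l : nat) (T : {poly int}) : {poly int} :=
  \sum_(i < l.+1) T`_i *: (('X^2 + rho%:P) ^+ i * 'X^(l - i)).

Lemma horner_joukowski rho l (T : {poly int}) (z : R[i]) : (size T <= l.+1)%N -> z != 0 ->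
  (toC (joukowski rho l T)).[z] = z ^+ l * (toC T).[z + rho%:~R / z].
Proof.
move=> szT z_neq0; rewrite /int_to_cpoly rmorph_sum /= horner_sum.
rewrite (@horner_coef_wide _ l.+1) ?size_map_inj_poly //; last exact: intr_inj.
rewrite mulr_sumr; apply: eq_bigr => -[i /= le_il] _.
rewrite map_polyZ /= hornerZ rmorphM rmorphXn rmorphD /= !map_polyXn map_polyC /=.
rewrite hornerM !(hornerXn, horner_exp, hornerD, hornerC) coef_map /= [RHS]mulrCA.
congr (_ * _); have -> : z ^+ l = z ^+ i * z ^+ (l - i) by rewrite -exprD subnKC.
rewrite mulrAC -exprMn; congr (_ ^+ _ * _).
by rewrite mulrDr mulrCA mulfV // mulr1 expr2.
Qed.

(** A root [x] of [T] contributes [X (X + rho / X - x) = X^2 - x X + rho]. *)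
Lemma joukowski_prod rho (xs : seq R) (T : {poly int}) :
  map_poly intr T = \prod_(x <- xs) ('X - x%:P) ->
  toC (joukowski rho (size xs) T) =
    \prod_(x <- xs) ('X^2 - x%:C *: 'X + (rho%:~R)%:P).
Proof.
move=> TE.
have szT : size T = (size xs).+1.
  by rewrite -(size_map_inj_poly (@intr_inj R) (rmorph0 _)) TE size_prod_XsubC.
have toCT : toC T = \prod_(x <- xs) ('X - x%:C%:P).
  have -> : toC T = map_poly (real_complex R) (map_poly intr T).
    by apply/polyP => i; rewrite !coef_map /= rmorph_int.
  rewrite TE rmorph_prod; apply: eq_bigr => x _.
  by rewrite rmorphB /= map_polyX map_polyC.
apply: poly_eq_off0 => z z_neq0.
rewrite horner_joukowski ?szT // toCT !horner_prod.
elim: xs {TE szT toCT} => [|x xs ihs]; first by rewrite !big_nil mulr1.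
rewrite !big_cons -ihs /= exprS hornerXsubC !(hornerD, hornerN, hornerZ, hornerXn, hornerX, hornerC).
by field.
Qed.

(** Every complex [y] equals [z + rho / z] for a nonzero [z], namely a root of [z^2 - y z + rho], so
    the transform determines all values of [T]. *)
Lemma joukowski_inj rho l (T1 T2 : {poly int}) : (0 < rho) ->
  (size T1 <= l.+1)%N -> (size T2 <= l.+1)%N ->
  joukowski rho l T1 = joukowski rho l T2 -> T1 = T2.
Proof.
move=> rho_gt0 sz1 sz2 eqJ; apply: (@toC_inj R); apply: poly_eq_off0 => y _.
pose z := (y + sqrtc (y ^+ 2 - 4 * rho%:~R)) / 2.
have zE : z ^+ 2 + rho%:~R = y * z.
  have := sqr_sqrtc (y ^+ 2 - 4 * rho%:~R); rewrite /z; set w := sqrtc _ => w2.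
  have -> : ((y + w) / 2) ^+ 2 = (y ^+ 2 + 2 * y * w + w ^+ 2) / 4 by field.
  by rewrite w2; field.
have z_neq0 : z != 0.
  apply/eqP => z0; move: zE; rewrite z0 expr0n mulr0 add0r => /eqP.
  by rewrite intr_eq0 gt_eqF.
have yE : y = z + rho%:~R / z.
  by apply: (mulIf z_neq0); rewrite mulrDl divfK // -zE expr2.
apply: (mulfI (expf_neq0 l z_neq0)).
by rewrite yE -!horner_joukowski // eqJ.
Qed.

(** The discriminant is not positive, so the two roots are conjugate, with product [rho]. *)
Lemma circle_factor (rho x : R) : 0 < rho -> x ^+ 2 <= 4 * rho ->
  exists2 z : R[i], 'X^2 - x%:C *: 'X + rho%:C%:P = ('X - z%:P) * ('X - z^*%C%:P)
    & modulus z = Num.sqrt rho.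
Proof.
move=> rho_gt0 le_x; pose y := Num.sqrt (rho - x ^+ 2 / 4).
have y2 : y ^+ 2 = rho - x ^+ 2 / 4 by rewrite sqr_sqrtr //; lra.
pose z : R[i] := (x / 2 +i* y)%C.
have zzJ : z * z^*%C = rho%:C.
  rewrite /z; apply/eqP; rewrite eq_complex /=; apply/andP; split; apply/eqP.
    by rewrite mulrN opprK -!expr2 y2; field.
  by ring.
exists z.
  have -> : x%:C = z + z^*%C.
    rewrite /z; apply/eqP; rewrite eq_complex /=; apply/andP; split; apply/eqP.
      by field.
    by rewrite subrr.
  by rewrite -zzJ -mul_polyC !(rmorphD, rmorphM) /=; ring.
have m2 : modulus z ^+ 2 = rho by apply: complexI; rewrite modulus_sqr zzJ.
by rewrite -m2 sqrtr_sqr ger0_norm ?modulus_ge0.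
Qed.

Lemma circle_product (rho : R) (xs : seq R) : 0 < rho ->
  (forall x, x \in xs -> x ^+ 2 <= 4 * rho) ->
  exists s : seq R[i], [/\ size s = (size xs).*2,
    \prod_(x <- xs) ('X^2 - x%:C *: 'X + rho%:C%:P) = \prod_(z <- s) ('X - z%:P)
    & forall z, z \in s -> modulus z = Num.sqrt rho].
Proof.
move=> rho_gt0; elim: xs => [|x xs ihs] le_xs.
  by exists [::]; split=> //; rewrite !big_nil.
have [|s [sz_s sE mod_s]] := ihs; first by move=> y ys; apply: le_xs; rewrite inE ys orbT.
have [z zE mod_z] := circle_factor rho_gt0 (le_xs x (mem_head _ _)).
exists [:: z, z^*%C & s]; split; first by rewrite /= sz_s.
  by rewrite !big_cons zE sE mulrA.
by move=> w; rewrite !inE => /or3P[/eqP ->|/eqP ->|/mod_s //]; rewrite ?modulusJ.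
Qed.

(** At a root with [|z| >= r], each of the [m] lower terms is at most [|z|^m / (m + 1)], too little
    to balance [z^m]. *)
Lemma small_roots (m r : nat) (a : 'I_m -> int) (z : R[i]) : (0 < r)%N ->
  (forall i, `|(a i)%:~R| <= r%:R ^+ (m - i) / m.+1%:R :> R) ->
  root (toC (monic_of a)) z -> modulus z < r%:R.
Proof.
move=> r_gt0 le_a; rewrite rootE horner_monic_of => /eqP eq0.
rewrite ltNge; apply/negP => ge_z.
have r_gt0' : 0 < r%:R :> R by rewrite ltr0n.
have z_gt0 : 0 < modulus z by apply: lt_le_trans ge_z.
have : modulus z ^+ m <= \sum_(i < m) modulus z ^+ m / m.+1%:R.
  have zm : z ^+ m = - \sum_(i < m) (a i)%:~R * z ^+ i.
    by apply/eqP; rewrite -addr_eq0 eq0.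
  rewrite -[leLHS]modulusX zm modulusN; apply: le_trans (modulus_sum _ _ _) _; apply: ler_sum => i _.
  rewrite modulusM !modulusX -(rmorph_int (real_complex R)) modulusR.
  have -> : modulus z ^+ m = modulus z ^+ (m - i) * modulus z ^+ i.
    by rewrite -exprD subnK // ltnW.
  rewrite mulrAC ler_wpM2r ?exprn_ge0 ?modulus_ge0 //; apply: le_trans (le_a i) _.
  by rewrite ler_wpM2r ?invr_ge0 // lerXn2r ?nnegrE ?ler0n ?modulus_ge0.
rewrite sumr_const card_ord -[_ *+ m]mulr_natr -mulrA ler_pMr ?exprn_gt0 //.
by rewrite mulrC ler_pdivlMr ?ltr0n // mul1r ler_nat ltnn.
Qed.

End Joukowski.

(** * The family of polynomials behind the lower bounds *)

Section Family.
Variables (R : realType) (e l m r D H : nat) (Par : finType).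
Variables (rho : Par -> nat) (u : Par -> {poly int}).
Local Notation toC := (int_to_cpoly R).
Local Notation k := (e + l.*2)%N.
Local Notation n := (k + m)%N.
Hypotheses (k_gt0 : (0 < k)%N) (D_gt0 : (0 < D)%N) (le_Dr : (D <= r)%N)
  (lD : (l.+1 ^ l.+1 <= D)%N) (mD : (m < D)%N)
  (rho_inj : injective rho) (rho_bounds : forall p, (r ^ 2 < rho p <= 4 * r ^ 2)%N)
  (u_roots : forall p, exists s : seq R[i], [/\ size s = e,
     toC (u p) = \prod_(z <- s) ('X - z%:P) &
     forall z, z \in s -> modulus z = Num.sqrt (rho p)%:R])
  (le_H : (4 ^ n * r ^ n <= H)%N).

(** Number of values for a coefficient of weight [d]. By [lD] and [mD], shifts up to [r^d / D] meet
    the conditions of [perturbation_real_rooted] and [small_roots]. *)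
Let N d := (r ^ d %/ D)%N.
Let r_gt0 : (0 < r)%N := leq_trans D_gt0 le_Dr.

Let N_le (d j : nat) : (j < N d)%N -> j%:R <= r%:R ^+ d / D%:R :> R.
Proof.
move=> lt_j; rewrite ler_pdivlMr ?ltr0n // -natrX -natrM ler_nat.
by rewrite -leq_divRL // ltnW.
Qed.

Let inner_poly (c : {dffun forall i : 'I_l, 'I_(N (l - i))}) : {poly int} :=
  monic_of (fun i : 'I_l =>
    Num.floor (r%:R ^+ (l - i) * (model_poly R l)`_i) + (nat_of_ord (c i))%:Z).

Let small_poly (d : {dffun forall i : 'I_m, 'I_(N (m - i))}) : {poly int} :=
  monic_of (fun i : 'I_m => (nat_of_ord (d i))%:Z).

Let outer_poly p c := u p * joukowski (rho p) l (inner_poly c).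

Let member (t : Par * {dffun forall i : 'I_l, 'I_(N (l - i))}
               * {dffun forall i : 'I_m, 'I_(N (m - i))}) : {poly int} :=
  outer_poly t.1.1 t.1.2 * small_poly t.2.

Let rho_gt0 p : (0 < rho p)%N.
Proof. by have /andP[lt1 _] := rho_bounds p; apply: leq_ltn_trans lt1. Qed.

Let r_lt_sqrt p : r%:R < Num.sqrt (rho p)%:R :> R.
Proof.
have /andP[lt1 _] := rho_bounds p.
rewrite -[ltLHS]ger0_norm ?ler0n // -sqrtr_sqr ltr_sqrt ?ltr0n //.
by rewrite -natrX ltr_nat.
Qed.

Let sqrt_le p : Num.sqrt (rho p)%:R <= 2 * r%:R :> R.
Proof.
have /andP[_ le2] := rho_bounds p.
rewrite -[leRHS]ger0_norm ?mulr_ge0 // -sqrtr_sqr ler_wsqrtr //.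
by rewrite exprMn -!natrX -natrM ler_nat.
Qed.

Let outer_roots p c : exists s : seq R[i], [/\ size s = k,
  toC (outer_poly p c) = \prod_(z <- s) ('X - z%:P) &
  forall z, z \in s -> modulus z = Num.sqrt (rho p)%:R].
Proof.
have [su [sz_su uE mod_su]] := u_roots p.
have [|xs [sz_xs TE lt_xs]] := @perturbation_real_rooted R l r
  (fun i : 'I_l => Num.floor (r%:R ^+ (l - i) * (model_poly R l)`_i)
                   + (nat_of_ord (c i))%:Z) r_gt0.
  move=> i; set x := _ * _; set b := r%:R ^+ (l - i) / _.
  have D_pos : 0 < D%:R :> R by rewrite ltr0n.
  have b_ge : r%:R ^+ (l - i) / D%:R <= b.
    rewrite ler_wpM2l ?exprn_ge0 // lef_pV2 ?posrE ?exprn_gt0 ?ltr0n //.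
    by rewrite -natrX ler_nat.
  (* The floor in [inner_poly] costs less than 1, which the allowed error absorbs because [D <= r]
     and [i < l]. *)
  have b_ge1 : 1 <= r%:R ^+ (l - i) / D%:R :> R.
    rewrite ler_pdivlMr // mul1r; apply: (@le_trans _ _ r%:R); first by rewrite ler_nat.
    by rewrite ler_eXnr ?ler1n // subn_gt0.
  have /andP[le_x lt_x] := floor_itv x.
  have le_c := N_le (ltn_ord (c i)).
  have c_ge0 : 0 <= (nat_of_ord (c i))%:R :> R := ler0n _ _.
  move: lt_x; rewrite !intrD -pmulrn => lt_x.
  by rewrite ler_norml; apply/andP; split; lra.
have rho_pos : 0 < (rho p)%:R :> R by rewrite ltr0n.
have [|s [sz_s sE mod_s]] := @circle_product R (rho p)%:R xs rho_pos.
  move=> x /lt_xs lt_x; rewrite -real_normK ?num_real //.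
  have /andP[lt1 _] := rho_bounds p.
  have : `|x| ^+ 2 <= r%:R ^+ 2 by rewrite lerXn2r ?nnegrE // ltW.
  have : r%:R ^+ 2 <= (rho p)%:R :> R by rewrite -natrX ler_nat ltnW.
  by lra.
exists (su ++ s); split; first by rewrite size_cat sz_su sz_s sz_xs.
  rewrite toCM uE big_cat; congr (_ * _); rewrite /inner_poly -{1}sz_xs.
  rewrite joukowski_prod // -sE; apply: eq_bigr => x _; congr (_ + _%:P).
  by rewrite -pmulrn rmorph_nat.
by move=> z; rewrite mem_cat => /orP[/mod_su|/mod_s].
Qed.

Let small_root d z : z \in croots (toC (small_poly d)) -> modulus z < r%:R.
Proof.
rewrite mem_croots; last by rewrite monic_toC monic_of_monic.
apply: small_roots => // i; rewrite -pmulrn normr_nat.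
apply: le_trans (N_le (ltn_ord (d i))) _.
rewrite ler_wpM2l ?exprn_ge0 // lef_pV2 ?posrE ?ltr0n //.
by rewrite ler_nat.
Qed.

Let member_roots t : exists s sh : seq R[i], [/\ size s = k, size sh = m,
  toC (outer_poly t.1.1 t.1.2) = \prod_(z <- s) ('X - z%:P),
  toC (member t) = \prod_(z <- s ++ sh) ('X - z%:P) &
  (forall z, z \in s -> modulus z = Num.sqrt (rho t.1.1)%:R) /\
  (forall z, z \in sh -> modulus z < Num.sqrt (rho t.1.1)%:R)].
Proof.
have [s [sz_s sE mod_s]] := outer_roots t.1.1 t.1.2.
have mh : toC (small_poly t.2) \is monic by rewrite monic_toC monic_of_monic.
exists s, (croots (toC (small_poly t.2))); split=> //.
- by rewrite size_croots // size_toC size_monic_of.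
- by rewrite toCM sE big_cat {1}(croots_monic mh).
- by split=> // z /small_root lt_z; apply: lt_trans lt_z _.
Qed.

Let member_max t : max_modulus (toC (member t)) = Num.sqrt (rho t.1.1)%:R.
Proof.
have [s [sh [sz_s _ _ -> [mod_s mod_sh]]]] := member_roots t.
rewrite max_modulus_prod (max_modulus_cat _ mod_s mod_sh) //.
by rewrite -size_eq0 sz_s -lt0n.
Qed.

Let member_Dset t : Dset R n k H (member t).
Proof.
have [s [sh [sz_s sz_sh _ fE [mod_s mod_sh]]]] := member_roots t.
have mf : member t \is monic by rewrite -(monic_toC R) fE monic_prod_XsubC.
have szf : size (member t) = n.+1.
  by rewrite -(size_toC R) fE size_prod_XsubC size_cat sz_s sz_sh.
split=> //.
  apply: height_leP => i; apply: leq_trans le_H.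
  have [lt_i|ge_i] := ltnP i (size (member t)); last by rewrite nth_default.
  rewrite -(ler_nat R) -modulus_int -coef_toC.
  apply: le_trans (coef_bound R mf lt_i) _; rewrite szf /= member_max.
  (* [coef_bound] gives [2^n] times a power of the radius, which is at most [2 r]; hence the height
     bound [4^n r^n]. *)
  have four : 4 = 2 * 2 :> R by rewrite -natrM.
  rewrite natrM !natrX four exprMn -mulrA ler_wpM2l ?exprn_ge0 //.
  rewrite -exprMn; apply: (@le_trans _ _ ((2 * r%:R) ^+ (n - i))).
    by rewrite lerXn2r ?nnegrE ?sqrtr_ge0 ?mulr_ge0.
  rewrite ler_weXn2l ?leq_subr // -natrM ler1n muln_gt0 /=.
  exact: r_gt0.
have := member_max t; rewrite /nb_max_roots => ->.
rewrite fE (seq.permP (croots_prod _)) count_cat.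
rewrite -[RHS]addn0 -[in RHS]sz_s; congr (_ + _)%N.
  by apply/eqP; rewrite -all_count; apply/allP => z /mod_s ->.
by apply/eqP; rewrite -leqn0 leqNgt -has_count; apply/hasPn => z /mod_sh /lt_eqF ->.
Qed.

Let outer_inj p : injective (outer_poly p).
Proof.
move=> c1 c2; rewrite /outer_poly => eq_c.
have u_neq0 : u p != 0.
  have [s [_ uE _]] := u_roots p; apply/eqP => u0.
  have := monic_neq0 (monic_prod_XsubC s xpredT id).
  by rewrite -uE u0 /int_to_cpoly rmorph0 eqxx.
have sz c : (size (inner_poly c) <= l.+1)%N by rewrite size_monic_of.
have rho_pos : 0 < (rho p)%:Z by rewrite ltz_nat.
have eqT := joukowski_inj R rho_pos (sz c1) (sz c2) (mulfI u_neq0 eq_c).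
apply/ffunP => i; apply/val_inj => /=.
have := congr1 (fun q : {poly int} => q`_i) eqT; rewrite !coef_monic_of.
by move/addrI => [].
Qed.

(** The largest modulus recovers [rho], hence the parameter; the roots on that circle recover the
    outer factor; cancelling it recovers the small one. *)
Let member_inj : injective member.
Proof.
move=> [[p1 c1] d1] [[p2 c2] d2] eq_t.
have eq_p : p1 = p2.
  apply: rho_inj; have := member_max (p1, c1, d1).
  rewrite eq_t member_max /= => /eqP; rewrite eqr_sqrt ?ler0n // eqr_nat.
  by move/eqP.
move: eq_t; rewrite -{p2}eq_p => eq_t.
have [s1 [h1 [_ _ o1 f1 [mod_s1 mod_h1]]]] := member_roots (p1, c1, d1).
have [s2 [h2 [_ _ o2 f2 [mod_s2 mod_h2]]]] := member_roots (p1, c2, d2).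
have eq_s : perm_eq (s1 ++ h1) (s2 ++ h2).
  by apply: prod_XsubC_eq; rewrite -f1 -f2 eq_t.
pose P (z : R[i]) := modulus z == Num.sqrt (rho p1)%:R.
have filt s h : (forall z, z \in s -> modulus z = Num.sqrt (rho p1)%:R) ->
    (forall z, z \in h -> modulus z < Num.sqrt (rho p1)%:R) -> filter P (s ++ h) = s.
  move=> mod_s mod_h; rewrite filter_cat; have -> : filter P s = s.
    by apply/all_filterP/allP => z /mod_s eq_z; rewrite /P eq_z.
  have -> : filter P h = [::].
    by apply/eqP; rewrite -size_eq0 size_filter -leqn0 leqNgt -has_count;
      apply/hasPn => z /mod_h /lt_eqF neq_z; rewrite /P neq_z.
  exact: cats0.
have eq_o : outer_poly p1 c1 = outer_poly p1 c2.
  by apply: (@toC_inj R); rewrite o1 o2; apply: perm_big; have := perm_filter P eq_s; rewrite !filt.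
have eq_c := outer_inj eq_o.
have o_neq0 : outer_poly p1 c1 != 0.
  apply/eqP => o0; have := monic_neq0 (monic_prod_XsubC s1 xpredT id).
  by rewrite -o1 /= o0 /int_to_cpoly rmorph0 eqxx.
have eq_h : small_poly d1 = small_poly d2.
  by apply: (mulfI o_neq0); rewrite {2}eq_o; apply: eq_t.
rewrite eq_c; congr (_, _); apply/ffunP => i; apply/val_inj => /=.
have := congr1 (fun q : {poly int} => q`_i) eq_h; rewrite !coef_monic_of.
by case.
Qed.

Lemma family_count :
  (#|Par| * \prod_(i < l) (r ^ (l - i) %/ D) * \prod_(i < m) (r ^ (m - i) %/ D)
     <= Dcount R n k H)%N.
Proof.
apply: leq_trans (card_fset_set_ge (Dset_finite R n k H) member_inj member_Dset).
rewrite !card_prod !card_dep_ffun !foldrE !big_map -!enumT !big_enum /=.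
apply: leq_mul; [apply: leq_mul => //|];
  by rewrite leq_eqVlt; apply/orP; left; apply/eqP; apply: eq_bigr => i _; rewrite card_ord.
Qed.

End Family.

(** * From the family to a power of [H] *)

Section LowerBound.
Variable R : realType.
Local Notation toC := (int_to_cpoly R).
Local Notation tri l := (\sum_(i < l) (l - i))%N.

Lemma double_triangular (l : nat) : (2 * tri l = l * (l + 1))%N.
Proof.
elim: l => [|l ihl]; first by rewrite big_ord0.
by rewrite big_ord_recl /= subn0 mulnDr ihl; lia.
Qed.

Lemma expn_leq2r (a b d : nat) : (a <= b)%N -> (a ^ d <= b ^ d)%N.
Proof. by case: d => // d; rewrite leq_exp2r. Qed.

(** Since [r^(l - i) >= D], rounding down the quotient by [D] loses at most a factor 2. *)
Lemma prod_divn_ge (l r D : nat) : (0 < D)%N -> (D <= r)%N ->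
  (r ^ tri l <= (2 * D) ^ l * \prod_(i < l) (r ^ (l - i) %/ D))%N.
Proof.
move=> D_gt0 le_Dr; have r_gt0 := leq_trans D_gt0 le_Dr.
rewrite expn_sum -[X in ((2 * D) ^ X)%N](card_ord l) -prod_nat_const -big_split /=.
apply: leq_prod => i _; have lt_i := ltn_ord i.
have le1 : (D <= r ^ (l - i))%N.
  by apply: leq_trans le_Dr _; rewrite -{1}[r]expn1 leq_pexp2l // subn_gt0.
have := ltn_ceil (r ^ (l - i)) D_gt0.
have : (0 < r ^ (l - i) %/ D)%N by rewrite divn_gt0.
by move: (r ^ (l - i) %/ D)%N (r ^ (l - i))%N => q x; nia.
Qed.

(** Covers the heights too small for the family: [X^(n - k) (X^k - 1)] always qualifies. *)
Lemma Dcount_gt0 (n k H : nat) : (0 < k)%N -> (k <= n)%N -> (0 < H)%N ->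
  (0 < Dcount R n k H)%N.
Proof.
move=> k_gt0 le_kn H_gt0; rewrite -[0%N]/(0 : nat) -card_unit.
apply: (card_fset_set_ge (g := fun _ : unit => 'X^(n - k) * ('X^k - 1) : {poly int})).
- exact: Dset_finite.
- by move=> [] [].
move=> _; set f := _ * _.
have mk : ('X^k - 1 : {poly R[i]}) \is monic by rewrite monicXnsubC.
have fE : toC f = \prod_(z <- croots ('X^k - 1) ++ nseq (n - k) 0) ('X - z%:P).
  rewrite big_cat -croots_monic // toCM mulrC; congr (_ * _).
    by rewrite /int_to_cpoly rmorphB rmorph1 /= map_polyXn.
  rewrite /int_to_cpoly map_polyXn; elim: (n - k)%N => [|d ihd].
    by rewrite big_nil expr0.
  by rewrite /= big_cons -ihd subr0 exprS.
have mf : f \is monic by rewrite -(monic_toC R) fE monic_prod_XsubC.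
have sz_k : size (croots ('X^k - 1 : {poly R[i]})) = k.
  by rewrite size_croots // size_XnsubC.
have mod1 z : z \in croots ('X^k - 1 : {poly R[i]}) -> modulus z = 1.
  rewrite mem_croots // rootE !(hornerD, hornerN, hornerXn, hornerC) subr_eq0 => /eqP zk.
  apply/eqP; rewrite -(pexpr_eq1 k_gt0) ?modulus_ge0 //.
  by rewrite -modulusX zk modulus1.
have mod0 z : z \in nseq (n - k) (0 : R[i]) -> modulus z < 1.
  by rewrite mem_nseq => /andP[_ /eqP ->]; rewrite modulus0 ltr01.
split=> //.
- by rewrite -(size_toC R) fE size_prod_XsubC size_cat sz_k size_nseq subnKC.
- apply: height_leP => i; apply: leq_trans H_gt0.
  rewrite /f mulrBr mulr1 -exprD subnK // coefB !coefXn.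
  by do 2![case: (_ == _)].
rewrite fE nb_max_roots_prod (max_modulus_cat _ mod1 mod0); last first.
  by rewrite -size_eq0 sz_k -lt0n.
rewrite count_cat -[RHS]addn0 -[in RHS]sz_k; congr (_ + _)%N.
  by apply/eqP; rewrite -all_count; apply/allP => z /mod1 ->.
by apply/eqP; rewrite -leqn0 leqNgt -has_count; apply/hasPn => z /mod0 /lt_eqF ->.
Qed.

(** Take the largest [r] with [(4 r)^n <= H], so that [r] has order [H^(1/n)]. The family then has
    at least about [r^a] parameters times the two boxes, of sizes about [r^(tri l)] and
    [r^(tri m)]. *)
Lemma Dcount_lower (e l m a : nat) : (0 < e + l.*2)%N ->
  (forall r, (0 < r)%N -> exists (Par : finType) (rho : Par -> nat) (u : Par -> {poly int}),
    [/\ injective rho, (forall p, (r ^ 2 < rho p <= 4 * r ^ 2)%N),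
      (forall p, exists s : seq R[i], [/\ size s = e,
        toC (u p) = \prod_(z <- s) ('X - z%:P) &
        forall z, z \in s -> modulus z = Num.sqrt (rho p)%:R]) &
      (r ^ a <= #|Par|)%N]) ->
  exists2 c : R, 0 < c & forall H, (1 <= H)%N ->
    c * H%:R `^ ((a + tri l + tri m)%N%:R / (e + l.*2 + m)%N%:R) <=
      (Dcount R (e + l.*2 + m) (e + l.*2) H)%:R.
Proof.
set k := (e + l.*2)%N; set n := (k + m)%N; set E := (a + tri l + tri m)%N.
move=> k_gt0 families; pose D := (l.+1 ^ l.+1 + m)%N.
have n_gt0 : (0 < n)%N by rewrite addn_gt0 k_gt0.
have D_gt0 : (0 < D)%N by rewrite addn_gt0 expn_gt0.
(* [(8 D)^E] absorbs the passage from [4 (r + 1)] to [8 r], or to [8 D] when [r < D];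
   [(2 D)^(l + m)] absorbs the loss in [prod_divn_ge]. *)
pose W := ((8 * D) ^ E * (2 * D) ^ (l + m))%N.
have W_gt0 : (0 < W)%N by rewrite muln_gt0 !expn_gt0 !muln_gt0 D_gt0.
exists (W%:R)^-1; first by rewrite invr_gt0 ltr0n.
move=> H H_gt0.
have D1 := Dcount_gt0 k_gt0 (leq_addr m k) H_gt0.
pose small r := (4 ^ n * r ^ n <= H)%N.
have ex_small : exists r, small r by exists 0%N; rewrite /small exp0n // muln0.
have small_le r : small r -> (r <= H)%N.
  move=> le_H; apply: leq_trans le_H; apply: (@leq_trans (r ^ n)).
    by case: (r) => // r'; rewrite -{1}[r'.+1]expn1 leq_pexp2l.
  by rewrite leq_pmull // expn_gt0.
case: (ex_maxnP ex_small small_le) => r le_H max_r.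
have lt_H : (H <= (4 * r.+1) ^ n)%N.
  by rewrite expnMn ltnW // ltnNge; apply/negP => /max_r; rewrite ltnn.
have le_pow : H%:R `^ (E%:R / n%:R) <= ((4 * r.+1) ^ E)%N%:R :> R.
  have n_neq0 : n%:R != 0 :> R by rewrite pnatr_eq0 -lt0n.
  apply: (@le_trans _ _ (((4 * r.+1) ^ n)%N%:R `^ (E%:R / n%:R))).
    by apply: ge0_ler_powR; rewrite ?nnegrE ?divr_ge0 ?ler0n // ler_nat.
  rewrite natrX -powR_mulrn ?ler0n // -powRrM mulrCA divff // mulr1.
  by rewrite powR_mulrn ?ler0n // natrX.
rewrite mulrC ler_pdivrMr ?ltr0n //; apply: le_trans le_pow _.
rewrite -natrM ler_nat.
have [lt_rD|le_Dr] := ltnP r D.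
  apply: (@leq_trans ((8 * D) ^ E)).
    by apply: expn_leq2r; lia.
  by rewrite /W [leqRHS]mulnC -mulnA leq_pmulr // muln_gt0 expn_gt0 muln_gt0 D_gt0 D1.
have r_gt0 := leq_trans D_gt0 le_Dr.
have [Par [rho [u [rho_inj rho_bounds u_roots le_Par]]]] := families r r_gt0.
have ltmD : (m < D)%N by rewrite -[m in (m < _)%N]add0n ltn_add2r expn_gt0.
have := family_count k_gt0 D_gt0 le_Dr (leq_addr _ _) ltmD rho_inj rho_bounds u_roots le_H.
rewrite -/k -/n; set p1 := (\prod_(i < l) _)%N; set p2 := (\prod_(i < m) _)%N => count.
have le_E : (r ^ E <= (2 * D) ^ (l + m) * Dcount R n k H)%N.
  apply: leq_trans (leq_mul (leqnn _) count).
  have -> : ((2 * D) ^ (l + m) * (#|Par| * p1 * p2) =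
             #|Par| * ((2 * D) ^ l * p1) * ((2 * D) ^ m * p2))%N by rewrite expnD; ring.
  by rewrite !expnD !leq_mul // prod_divn_ge.
apply: (@leq_trans ((8 * r) ^ E)); first by apply: expn_leq2r; lia.
have -> : (Dcount R n k H * W = 8 ^ E * (D ^ E * ((2 * D) ^ (l + m) * Dcount R n k H)))%N.
  by rewrite /W [((8 * D) ^ E)%N]expnMn; move: (8 ^ E)%N (D ^ E)%N ((2 * D) ^ _)%N => x y z; ring.
rewrite expnMn leq_mul2l; apply/orP; right; apply: leq_trans le_E _.
by rewrite leq_pmull // expn_gt0 D_gt0.
Qed.

End LowerBound.

(** * The lower bounds for both parities *)

Section LowerBounds.
Variables (R : realType) (n k : nat).
Hypotheses (k_ge3 : (3 <= k)%N) (k_le_n : (k <= n)%N).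

Let k_gt0 : (0 < k)%N. Proof. by apply: leq_trans k_ge3. Qed.

Let n_neq0 : n%:R != 0 :> R.
Proof. by rewrite pnatr_eq0 -lt0n (leq_trans k_gt0). Qed.

Let tri_real l : (\sum_(i < l) (l - i))%N%:R = l%:R * (l%:R + 1) / 2 :> R.
Proof.
have := congr1 (fun x => x%:R : R) (double_triangular l).
by rewrite !natrM natrD => eq2; lra.
Qed.

Lemma Dcount_lower_even : ~~ odd k -> exists2 c : R, 0 < c & forall H, (1 <= H)%N ->
  c * H%:R `^ ((n%:R + 1) / 2 - k%:R + (5 * k%:R ^+ 2 - 2 * k%:R + 16) / (8 * n%:R))
    <= (Dcount R n k H)%:R.
Proof.
move=> even_k; pose l := k./2; pose m := (n - k)%N.
have kE : (0 + l.*2)%N = k by rewrite add0n -[RHS]odd_double_half (negbTE even_k).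
have nE : (0 + l.*2 + m)%N = n by rewrite kE subnKC.
have [||c c_gt0 le_c] := @Dcount_lower R 0 l m 2; first by rewrite kE.
  move=> r r_gt0.
  (* For even [k] every integer [rho] in [(r^2, 4 r^2]] is allowed, which gives [3 r^2] parameters
     and [a = 2]. *)
  exists 'I_(3 * r ^ 2), (fun p : 'I_(3 * r ^ 2) => r ^ 2 + p.+1)%N, (fun _ => 1); split.
  - by move=> p q /addnI [] /val_inj.
  - by move=> [p lt_p] /=; rewrite -[X in (X < _)%N]addn0 ltn_add2l /=; move: (r ^ 2)%N lt_p => x; lia.
  - move=> p; exists [::]; split=> //.
    by rewrite big_nil /int_to_cpoly rmorph1.
  - by rewrite card_ord leq_pmull.
exists c => // H H_gt0; have := le_c H H_gt0; rewrite nE kE.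
have -> // : (2 + (\sum_(i < l) (l - i))%N + (\sum_(i < m) (m - i))%N)%N%:R / n%:R =
  (n%:R + 1) / 2 - k%:R + (5 * k%:R ^+ 2 - 2 * k%:R + 16) / (8 * n%:R) :> R.
rewrite !natrD !tri_real.
have -> : k%:R = 2 * l%:R :> R by rewrite -kE add0n -mul2n natrM.
have -> : m%:R = n%:R - 2 * l%:R :> R by rewrite natrB // -{1}kE add0n -mul2n natrM.
by field.
Qed.

Lemma Dcount_lower_odd : odd k -> exists2 c : R, 0 < c & forall H, (1 <= H)%N ->
  c * H%:R `^ ((n%:R + 1) / 2 - k%:R + (5 * k%:R ^+ 2 - 4 * k%:R + 7) / (8 * n%:R))
    <= (Dcount R n k H)%:R.
Proof.
move=> odd_k; pose l := k./2; pose m := (n - k)%N.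
have kE : (1 + l.*2)%N = k by rewrite -[RHS]odd_double_half odd_k.
have nE : (1 + l.*2 + m)%N = n by rewrite kE subnKC.
have [||c c_gt0 le_c] := @Dcount_lower R 1 l m 1; first by rewrite kE.
  move=> r r_gt0.
  (* For odd [k] the real root [s] runs over the integers in [(r, 2 r]] and [rho = s^2], which gives
     [r] parameters and [a = 1]. *)
  exists 'I_r, (fun p : 'I_r => (r + p.+1) ^ 2)%N, (fun p : 'I_r => 'X - (r + p.+1)%N%:Z%:P); split.
  - move=> p q /eqP; rewrite eqn_exp2r // => /eqP /addnI [] /val_inj //.
  - move=> [p lt_p] /=; rewrite ltn_exp2r // -[X in (X < _)%N]addn0 ltn_add2l /=.
    by rewrite -[4%N]/(2 ^ 2)%N -expnMn leq_exp2r //; lia.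
  - move=> p; exists [:: ((r + p.+1)%N%:R)]; split=> //.
      by rewrite big_seq1 /int_to_cpoly rmorphB /= map_polyX map_polyC.
    move=> z; rewrite inE => /eqP ->.
    by rewrite modulus_nat natrX sqrtr_sqr ger0_norm ?ler0n.
  - by rewrite card_ord expn1.
exists c => // H H_gt0; have := le_c H H_gt0; rewrite nE kE.
have -> // : (1 + (\sum_(i < l) (l - i))%N + (\sum_(i < m) (m - i))%N)%N%:R / n%:R =
  (n%:R + 1) / 2 - k%:R + (5 * k%:R ^+ 2 - 4 * k%:R + 7) / (8 * n%:R) :> R.
rewrite !natrD !tri_real.
have kR : k%:R = 1 + 2 * l%:R :> R by rewrite -kE natrD -mul2n natrM.
have -> : m%:R = n%:R - (1 + 2 * l%:R) :> R by rewrite natrB // kR.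
by rewrite kR; field.
Qed.

End LowerBounds.

Theorem theorem1p1 (R : realType) (n k : nat) (k_ge3 : (3 <= k)%N)
    (k_le_n : (k <= n)%N) :
  exists c1 c2 : R, 0 < c1 /\ 0 < c2 /\
  forall H : nat, (1 <= H)%N ->
    (odd k ->
      c1 * H%:R `^ ((n%:R + 1) / 2 - k%:R
                    + (5 * k%:R ^+ 2 - 4 * k%:R + 7) / (8 * n%:R))
        <= (Dcount R n k H)%:R
      /\ (Dcount R n k H)%:R <= c2 * H%:R `^ (n%:R - (k%:R + 1) / 2))
    /\
    (~~ odd k ->
      c1 * H%:R `^ ((n%:R + 1) / 2 - k%:R
                    + (5 * k%:R ^+ 2 - 2 * k%:R + 16) / (8 * n%:R))
        <= (Dcount R n k H)%:R
      /\ (Dcount R n k H)%:R <= c2 * H%:R `^ (n%:R - (k%:R - 1) / 2)).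
Proof.
have [odd_k|even_k] := boolP (odd k).
  have [c1 c1_gt0 lower] := Dcount_lower_odd R k_ge3 k_le_n odd_k.
  have [c2 c2_gt0 upper] := Dcount_upper_odd R k_ge3 k_le_n odd_k.
  exists c1, c2; do 2!split=> //; move=> H H_gt0; split=> // _.
  by split; [apply: lower|apply: upper].
have [c1 c1_gt0 lower] := Dcount_lower_even R k_ge3 k_le_n even_k.
have [c2 c2_gt0 upper] := Dcount_upper_even R k_ge3 k_le_n.
exists c1, c2; do 2!split=> //; move=> H H_gt0; split=> // _.
by split; [apply: lower|apply: upper].
Qed.
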